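(* Let $\lambda$ and $\mu$ be partitions. Then $$\Delta\left(\mathrm{R}^{\lambda\,\varnothing}\cdot \mathrm{R}^{\varnothing\,\mu}\right)=\mathrm{R}^{\lambda\,\mu}.$$
   Context: A partition is a finite weakly decreasing sequence of non-negative integers (extended by zeros when needed); $\varnothing$ is the trivial partition. Let $\sigma(t)=\exp\left(\sum_{k>0}\frac{p_k}{k}t^k+\frac{\tilde p_k}{k}t^{-k}\right)$ be a function on the unit circle, with $p_k,\tilde p_k\in\mathbb{C}$ such that $\sum_k\frac{|p_k|}{k}$, $\sum_k\frac{|\tilde p_k|}{k}$ and $\sum_k\frac{|p_k\tilde p_k|}{k}$ are finite, and let $d_k$ ($k\in\mathbb{Z}$) be its Fourier coefficients, $\sigma(t)=\sum_{k\in\mathbb{Z}}d_kt^k$. For partitions $\lambda,\mu$ of length at most $n$ let $$M_n^{\lambda\,\mu}(\sigma)=\left(d_{\lambda_i-\mu_j-i+j}\right)_{1\le i,j\le n},\qquad M_n(\sigma)=M_n^{\varnothing\,\varnothing}(\sigma)=(d_{j-i})_{1\le i,j\le n},$$ and $$\mathrm{R}^{\lambda\,\mu}(\sigma)=\lim_{n\to\infty}\frac{\det M_n^{\lambda\,\mu}(\sigma)}{\det M_n(\sigma)}.$$ It is known (Bump–Diaconis, Tracy–Widom) that this limit exists and that it is a polynomial expression with rational coefficients in the $p_k,\tilde p_k$, the same for all such $\sigma$. In the claim, $\mathrm{R}^{\lambda\,\mu}$ denotes this polynomial, i.e. the unique polynomial over $\mathbb{Q}$ in independent variables $p_1,p_2,\dots,\tilde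 p_1,\tilde p_2,\dots$ whose value at the coefficients of $\log\sigma$ is $\mathrm{R}^{\lambda\,\mu}(\sigma)$ for all such $\sigma$. The operator $\Delta$ is $$\Delta=\exp\left(\sum_{k>0}k\,\partial_{p_k}\partial_{\tilde p_k}\right)=\prod_{k>0}\sum_{i\ge0}\frac{k^i}{i!}(\partial_{p_k}\partial_{\tilde p_k})^i,$$ where powers denote composition; on a polynomial in the $p_k,\tilde p_k$ only finitely many terms contribute. *)

(* Defs.v *)
(* [R[i]] is the field of complex numbers over [R : realType]. *)
From HB Require Import structures.
From mathcomp Require Import all_boot all_order all_algebra.
From mathcomp Require Import all_classical all_reals all_analysis.
From mathcomp Require Import complex.
(* The notations of mpoly.v clash with those of MathComp-Analysis. *)
From mathcomp Require Import -(notations) mpoly.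

Set Implicit Arguments.
Unset Strict Implicit.
Unset Printing Implicit Defensive.

Import Order.TTheory GRing.Theory Num.Theory.
Import numFieldNormedType.Exports.

Local Open Scope classical_set_scope.
Local Open Scope complex_scope.
Local Open Scope ring_scope.

(* Trailing zeros are allowed; parts are read with [nth 0], which extends the
   sequence by zeros. *)
Definition is_partition (lam : seq nat) : Prop := sorted geq lam.

Section Symbol.
Variable R : realType.

Definition cis (x : R) : R[i] := cos x +i* sin x.

Definition cexp (z : R[i]) : R[i] := (expR (complex.Re z))%:C * cis (complex.Im z).

(* Here and below, sequences p and q stand for (p_k) and (p~_k); only the
   values at k > 0 are used. *)
Definition log_symbol (p q : nat -> R[i]) (t : R[i]) : R[i] :=
  limn (series (fun k : nat =>
    p k.+1 / k.+1%:R * t ^+ k.+1 + q k.+1 / k.+1%:R * t ^- k.+1 : R[i]^o)).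

Definition symbol (p q : nat -> R[i]) (t : R[i]) : R[i] :=
  cexp (log_symbol p q t).

Definition admissible (p q : nat -> R[i]) : Prop :=
  [/\ cvgn (series (fun k : nat => Normc.normc (p k.+1) / k.+1%:R)),
      cvgn (series (fun k : nat => Normc.normc (q k.+1) / k.+1%:R)) &
      cvgn (series (fun k : nat => Normc.normc (p k.+1 * q k.+1) / k.+1%:R))].

Definition circle_integral (f : R[i] -> R[i]) : R[i] :=
  (\int[lebesgue_measure]_(x in `[0%R, (2 * pi)%R]) complex.Re (f (cis x)))
  +i* (\int[lebesgue_measure]_(x in `[0%R, (2 * pi)%R]) complex.Im (f (cis x))).

Definition fourier (f : R[i] -> R[i]) (k : int) : R[i] :=
  circle_integral (fun t => f t * t ^ (- k)) / (2 * pi)%:C.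

(* The indices i, j start at 0 here; only their difference matters. *)
Definition toeplitz (lam mu : seq nat) (d : int -> R[i]) (n : nat) : 'M[R[i]]_n :=
  \matrix_(i < n, j < n)
    d ((nth 0%N lam i)%:Z - (nth 0%N mu j)%:Z - i%:Z + j%:Z).

End Symbol.

(* Polynomials in p_1, ..., p_N, p~_1, ..., p~_N: among the N + N variables,
   [lshift N k] is p_(k+1) and [rshift N k] is p~_(k+1). *)
Definition eval_at (R : realType) (N : nat) (p q : nat -> R[i])
    (P : mpoly (N + N) rat) : R[i] :=
  mpoly.mmap ratr
    (fun v : 'I_(N + N) =>
       match fintype.split v with inl k => p k.+1 | inr k => q k.+1 end) P.

(* [P] is the polynomial R^(lam mu): for every admissible sigma, its value at
   the coefficients of log sigma is the limit of the ratio of determinants. *)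
Definition is_toeplitz_poly (R : realType) (lam mu : seq nat) (N : nat)
    (P : mpoly (N + N) rat) : Prop :=
  forall p q : nat -> R[i], admissible p q ->
    let d := fourier (symbol p q) in
    (\det (toeplitz lam mu d n) / \det (toeplitz [::] [::] d n) : R[i]^o)
      @[n --> \oo] --> (eval_at p q P : R[i]^o).

Definition weighted_laplacian (N : nat) (P : mpoly (N + N) rat) :
    mpoly (N + N) rat :=
  \sum_(k < N) k.+1%:R *: mderiv (lshift N k) (mderiv (rshift N k) P).

(* The exponential of [weighted_laplacian]. This operator lowers the total
   degree by two, so the terms with j >= [mmeasure mdeg P] (the total degree of
   P plus one, or 0 if P = 0) vanish. *)
Definition Delta (N : nat) (P : mpoly (N + N) rat) : mpoly (N + N) rat :=
  \sum_(j < mmeasure mdeg P)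
    ((j : nat)`!%:R : rat)^-1 *: iter j (@weighted_laplacian N) P.

(* Main.v *)
(* For p_k = sum_i x_i^k and p~_k = sum_j y_j^k with finitely many x_i, y_j in
   (0, 1), the symbol is prod_i (1 - x_i t)^-1 prod_j (1 - y_j / t)^-1. Multiplying
   by prod_j (1 - y_j / t) gives linear recursions for the Fourier coefficients, and
   column operations based on them show that the ratio of Toeplitz determinants is
   equal, as soon as n is large, to the finite determinant
     J(p, q) = det_{i,j <= l} (sum_{c <= l} h_{c - i + lam_i}(p) h_{c - j + mu_j}(q)),
   where h_n are the complete homogeneous functions; no limit has to be computed.
   Such (p, p~) are Zariski dense, so R^(lam mu) takes the value J(p, q) at every pair
   of sequences; for mu (resp. lam) empty, J is the Jacobi-Trudi determinant.
   On the other side, [Delta, p_k] = k d/dp~_k Delta and k d/dp~_k h_n = h_{n-k} imply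
   that Delta (F(p) prod_r h_{n_r}(p~)) is the coefficient of t^n in
   F(p + power sums of t) prod_r H(p~; t_r). Summing over the Jacobi-Trudi expansion
   of R^(0 mu) inserts a Vandermonde determinant in t, whose product with
   R^(lam 0)(p + power sums of t) is a determinant with columns in separate variables;
   extracting coefficients column by column gives J. *)
Require Import Defs.
From HB Require Import structures.
From mathcomp Require Import all_boot all_order all_algebra.
From mathcomp Require Import all_classical all_reals all_analysis.
From mathcomp Require Import complex.
From mathcomp Require Import -(notations) mpoly.
From mathcomp Require Import perm.
From mathcomp Require Import zify ring lra.
Import Order.TTheory GRing.Theory Num.Theory.

Set Implicit Arguments.
Unset Strict Implicit.
Unset Printing Implicit Defensive.

Local Open Scope classical_set_scope.
Local Open Scope complex_scope.
Local Open Scope ring_scope.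

(** Each R^(lam mu) is known only through its values, whereas Delta acts on polynomials, so values
    have to be turned back into polynomial identities. For that, sequences vanishing beyond N
    suffice, and on these the h_n agree with their versions in the N truncated variables. The
    formula for R^(lam 0), however, is also needed at p + power sums of t, which do not vanish
    beyond N; hence density has to reach arbitrary sequences and not just points of an affine space.
    Dividing by det M_n requires it to be nonzero; for the test symbols this is shown by a kernel
    argument, without computing its value. Taking the x_i, y_j real in (0, 1) makes - log (1 - r
    e^(i theta)) a function of a real variable r, to be treated by differentiation, with no branch
    of the logarithm. The Fourier coefficients come from a functional equation together with
    boundedness, not from expanding the product. The h_n are handled throughout by Newton's
    identities n h_n = sum_k p_k h_(n-k), so one definition serves for numbers and for
    polynomials. *)

Lemma nth_le_sumn (s : seq nat) i : (nth 0 s i <= sumn s)%N.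
Proof.
have [lt_i|ge_i] := ltnP i (size s); last by rewrite nth_default.
by rewrite -(cat_take_drop i s) sumn_cat (drop_nth 0) //= nth_cat size_take
  lt_i ltnn subnn /= addnCA leq_addr.
Qed.

(** * Linear recursions and complete homogeneous functions *)

Section PolynomialAction.
Variable K : comNzRingType.
Implicit Types (e : {poly K}) (u : int -> K).

(* Multiplication of the two-sided series u by the polynomial e. *)
Definition act e u (k : int) : K := \sum_(i < size e) e`_i * u (k - i%:Z).

Lemma act_wide e u k n : (size e <= n)%N ->
  act e u k = \sum_(i < n) e`_i * u (k - i%:Z).
Proof.
move=> le_en; rewrite /act (big_ord_widen n (fun i => e`_i * u (k - i%:Z))) //.
rewrite big_mkcond; apply: eq_bigr => i _; case: ifPn => //.
by rewrite -leqNgt => le_ei; rewrite nth_default // mul0r.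
Qed.

Lemma actD e1 e2 u k : act (e1 + e2) u k = act e1 u k + act e2 u k.
Proof.
pose n := maxn (size e1) (size e2).
rewrite (act_wide u k (size_polyD e1 e2)) (@act_wide e1 u k n) ?leq_maxl //.
rewrite (@act_wide e2 u k n) ?leq_maxr // -big_split.
by apply: eq_bigr => i _; rewrite coefD mulrDl.
Qed.

Lemma act0 u k : act 0 u k = 0.
Proof. by rewrite /act size_poly0 big_ord0. Qed.

Lemma actC c u k : act c%:P u k = c * u k.
Proof.
by rewrite (act_wide u k (size_polyC_leq1 c)) big_ord1 coefC eqxx subr0.
Qed.

Lemma actMX e u k : act (e * 'X) u k = act e u (k - 1).
Proof.
have sz : (size (e * 'X)%R <= (size e).+1)%N.
  by rewrite (leq_trans (size_polyMleq _ _)) // size_polyX addn2.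
rewrite (act_wide u k sz) big_ord_recl coefMX eqxx mul0r add0r.
apply: eq_bigr => i _; rewrite coefMX /=; congr (_ * u _).
by rewrite /bump leq0n; lia.
Qed.

Lemma actM e1 e2 u k : act (e1 * e2) u k = act e1 (act e2 u) k.
Proof.
elim/poly_ind: e1 k => [|e1 c IH] k; first by rewrite mul0r !act0.
rewrite mulrDl !actD -mulrA (mulrC 'X) mulrA !actMX IH actC; congr (_ + _).
elim/poly_ind: e2 {IH} k => [|e2 b IH] k.
  by rewrite mulr0 act0 mulr0.
by rewrite mulrDr mulrA !actD !actMX IH -polyCM !actC mulrDr mulrA.
Qed.

Lemma act1 u k : act 1 u k = u k.
Proof. by rewrite actC mul1r. Qed.

Lemma act_lin x u k : act (1 - x *: 'X) u k = u k - x * u (k - 1).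
Proof.
have -> : 1 - x *: 'X = (- x)%:P * 'X + 1%:P by rewrite addrC -mul_polyC polyCN mulNr.
by rewrite actD actMX !actC mul1r mulNr addrC.
Qed.

Lemma eq_act e u v : u =1 v -> act e u =1 act e v.
Proof. by move=> uv k; apply: eq_bigr => i _; rewrite uv. Qed.

(** The inverse of the generating series of the h_n in the variables [xs]: acting with it removes
    these variables, one linear factor at a time. *)
Definition locator (xs : seq K) : {poly K} := \prod_(x <- xs) (1 - x *: 'X).

Lemma locator_cons x xs : locator (x :: xs) = (1 - x *: 'X) * locator xs.
Proof. exact: big_cons. Qed.

Lemma locator0 xs : (locator xs)`_0 = 1.
Proof.
elim: xs => [|x xs IH]; first by rewrite /locator big_nil coef1.
by rewrite locator_cons coef0M IH coefB coefZ coefX coef1 mulr0 subr0 mulr1.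
Qed.

Lemma size_locator xs : (size (locator xs) <= (size xs).+1)%N.
Proof.
elim: xs => [|x xs IH]; first by rewrite /locator big_nil size_poly1.
rewrite locator_cons (leq_trans (size_polyMleq _ _)) //.
have : (size (1 - x *: 'X)%R <= 2)%N.
  by rewrite (leq_trans (size_polyD _ _)) // size_polyN geq_max size_poly1
    (leq_trans (size_scale_leq _ _)) // size_polyX.
by rewrite -subn1 leq_subLR add1n => le2; rewrite (leq_trans (leq_add le2 IH)) //= ?add2n.
Qed.

End PolynomialAction.

Section CompleteHomogeneous.
Variable K : comUnitRingType.
Implicit Types (p : nat -> K).

(** Newton's identity calls all earlier values, so the whole prefix h_0, ..., h_n is built by
    structural recursion. *)
Fixpoint chom_prefix p n : seq K :=
  if n is m.+1 then
    rcons (chom_prefix p m)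
      (m.+1%:R^-1 * \sum_(k < m.+1) p k.+1 * (chom_prefix p m)`_(m - k))
  else [:: 1].

(* The complete homogeneous symmetric functions, as polynomials in the power
   sums [p 1, p 2, ...]. *)
Definition chom p n : K := (chom_prefix p n)`_n.

Definition chomz p (k : int) : K := if k is Posz n then chom p n else 0.

Definition jacobi_trudi (lam : seq nat) l p : 'M[K]_l :=
  \matrix_(i < l, j < l) chomz p (j%:Z - i%:Z + (nth 0%N lam i)%:Z).

Lemma size_chom_prefix p n : size (chom_prefix p n) = n.+1.
Proof. by elim: n => //= n IH; rewrite size_rcons IH. Qed.

Lemma nth_chom_prefix p n m : (m <= n)%N -> (chom_prefix p n)`_m = chom p m.
Proof.
elim: n => [|n IH]; first by rewrite leqn0 => /eqP->.
rewrite leq_eqVlt => /orP[/eqP->//|lt_mn] /=.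
by rewrite nth_rcons size_chom_prefix lt_mn IH.
Qed.

Lemma chom0 p : chom p 0 = 1. Proof. by []. Qed.

Hypothesis natU : forall n, (n.+1%:R : K) \is a GRing.unit.

Lemma chomS p n : n.+1%:R * chom p n.+1 = \sum_(k < n.+1) p k.+1 * chom p (n - k).
Proof.
rewrite {1}/chom /= nth_rcons size_chom_prefix ltnn eqxx mulrA divrr // mul1r.
by apply: eq_bigr => k _; rewrite nth_chom_prefix // leq_subr.
Qed.

Lemma chom_uniq p h : h 0%N = 1 ->
  (forall n, n.+1%:R * h n.+1 = \sum_(k < n.+1) p k.+1 * h (n - k)%N) ->
  forall n, h n = chom p n.
Proof.
move=> h0 hS; elim/ltn_ind => -[|n] IH; first by rewrite h0.
apply: (mulrI (natU n)); rewrite hS chomS.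
by apply: eq_bigr => k _; rewrite IH // ltnS leq_subr.
Qed.

Lemma eq_chom p p' n : (forall k, (0 < k <= n)%N -> p k = p' k) ->
  chom p n = chom p' n.
Proof.
elim/ltn_ind: n => -[|n] IH pp' //; apply: (mulrI (natU n)); rewrite !chomS.
apply: eq_bigr => k _; rewrite pp' ?ltn_ord // IH ?ltnS ?leq_subr // => j Hj.
by apply: pp'; lia.
Qed.

(** Adjoining a variable x divides the generating series by 1 - x t. Since h is available only
    through Newton's identities, the proof is a strong induction on the index. *)
Lemma chom_pow_recl p p' x : (forall k, (0 < k)%N -> p' k = p k + x ^+ k) ->
  forall k, chomz p' k - x * chomz p' (k - 1) = chomz p k.
Proof.
move=> pp' [|]; last by move=> n; rewrite /= mulr0 subr0.
elim/ltn_ind => -[|n] IH; first by rewrite /= mulr0 subr0.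
have -> : n.+1%:Z - 1 = n by lia.
apply: (mulrI (natU n)); rewrite /= mulrBr !chomS.
(* Newton's sum for [p] with each h_(n-k)(p) replaced by the induction hypothesis; the last term,
   h_0, needs no correction. *)
have E : \sum_(k < n.+1) p k.+1 * chom p (n - k) =
  \sum_(k < n.+1) p k.+1 * chom p' (n - k)
  - x * \sum_(k < n) p k.+1 * chom p' (n - k.+1).
  rewrite [X in _ = X - _]big_ord_recr big_ord_recr subnn !chom0 /= [RHS]addrAC.
  congr (_ + _); rewrite mulr_sumr -sumrB; apply: eq_bigr => k _.
  have := IH (n - k)%N; rewrite ltnS leq_subr => /(_ isT) /= <-.
  rewrite mulrBr; congr (_ - _).
  have -> : (n - k)%N%:Z - 1 = (n - k.+1)%N%:Z by have := ltn_ord k; lia.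
  by rewrite mulrCA.
rewrite E.
under eq_bigr do rewrite pp' // mulrDl.
rewrite big_split /= -addrA; congr (_ + _).
rewrite big_ord_recl subn0 expr1.
have -> : \sum_(i < n) x ^+ (lift ord0 i).+1 * chom p' (n - lift ord0 i) =
    x * \sum_(k < n) x ^+ k.+1 * chom p' (n - k.+1).
  by rewrite mulr_sumr; apply: eq_bigr => k _; rewrite exprS -mulrA.
rewrite -natr1 mulrDl mul1r opprD [- _ - _]addrC addrACA subrr add0r.
rewrite [n%:R * _]mulrCA -mulrBr -[RHS]mulrN; congr (x * _).
(* What is left is x times Newton's identity for [p'] at index n. *)
case: n {E IH} => [|n]; first by rewrite !big_ord0 mul0r subrr oppr0.
rewrite chomS; apply/eqP; rewrite subr_eq addrC -sumrB.
apply/eqP; apply: eq_bigr => k _; rewrite pp' // subSS; ring.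
Qed.

End CompleteHomogeneous.

(** * Toeplitz determinants *)

Section ToeplitzDeterminant.
Variable K : fieldType.
Hypothesis natU : forall n, (n.+1%:R : K) \is a GRing.unit.
Implicit Types (p q : nat -> K) (xs ys : seq K) (lam mu : seq nat).

Definition psum xs (k : nat) : K := \sum_(x <- xs) x ^+ k.

Lemma chomz0 k : chomz (psum [::]) k = (k == 0)%:R.
Proof.
case: k => // n; rewrite /chomz -(chom_uniq natU (h := fun n => (n == 0%N)%:R)) //.
move=> {}n; rewrite mulr0 big1 // => k _.
by rewrite /psum big_nil mul0r.
Qed.

Lemma act_locator_chomz xs k : act (locator xs) (chomz (psum xs)) k = (k == 0)%:R.
Proof.
elim: xs k => [|x xs IH] k; first by rewrite /locator big_nil act1 chomz0.
rewrite locator_cons mulrC actM -IH; apply: eq_act => j.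
rewrite act_lin; apply: (chom_pow_recl natU) => n _.
by rewrite /psum big_cons addrC.
Qed.

Lemma chom_locator_conv ys s :
  \sum_(f < s.+1) chom (psum ys) f * (locator ys)`_(s - f) = (s == 0%N)%:R.
Proof.
rewrite -[RHS](act_locator_chomz ys s).
rewrite (@act_wide _ _ _ _ (s.+1 + (size (locator ys)))) ?leq_addl //.
rewrite big_split_ord /= [X in _ + X]big1 ?addr0 => [|i _]; last first.
  have -> : s%:Z - (s.+1 + i)%N%:Z = Negz i by rewrite NegzE; lia.
  by rewrite /= mulr0.
rewrite (reindex_inj rev_ord_inj) /=; apply: eq_bigr => f _.
have lefs : (f <= s)%N by have := ltn_ord f; lia.
by rewrite subSS mulrC subKn // subzn.
Qed.

(** The matrix [toeplitz] over an arbitrary field; over R[i] the two are convertible. *)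
Definition toep lam mu (d : int -> K) n : 'M[K]_n :=
  \matrix_(i < n, j < n)
    d ((nth 0%N lam i)%:Z - (nth 0%N mu j)%:Z - i%:Z + j%:Z).

(* With a_i = i - lam_i and b_j = j - mu_j, the entries are the sums over c < l
   of h_{c - a_i}(p) h_{c - b_j}(q), where [c = l - 1 - e]; they do not depend
   on L as soon as L >= l + lam_i for all i. *)
Definition jt lam mu l L p q : 'M[K]_l :=
  \matrix_(i < l, j < l) \sum_(e < L)
     chomz p (l%:Z - 1 - e%:Z - i%:Z + (nth 0%N lam i)%:Z) *
     chomz q (l%:Z - 1 - e%:Z - j%:Z + (nth 0%N mu j)%:Z).

(** For e >= L one of the two factors has a negative index. One factor is enough, whence the
    disjunction: if one partition is empty, the sum may be cut at l. *)
Lemma jt_wide lam mu l L L' p q : (L <= L')%N ->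
  (forall i j, (l + nth 0 lam i <= L)%N || (l + nth 0 mu j <= L)%N) ->
  jt lam mu l L p q = jt lam mu l L' p q.
Proof.
move=> leL bound; apply/matrixP => i j; rewrite !mxE.
rewrite -(subnK leL) addnC big_split_ord /= [X in _ = _ + X]big1 ?addr0 // => e _.
have neg (m : nat) (b : nat) : (l + b <= L)%N ->
    l%:Z - 1 - (L + e)%N%:Z - m%:Z + b%:Z = Negz (L - (l + b) + e + m).
  by rewrite NegzE; lia.
by have /orP[/neg->|/neg->] := bound i j; rewrite /= ?mul0r ?mulr0.
Qed.

Lemma jt_tr lam mu l L p q : (jt lam mu l L p q)^T = jt mu lam l L q p.
Proof.
by apply/matrixP => i j; rewrite !mxE; apply: eq_bigr => e _; rewrite mulrC.
Qed.

Lemma chomz_ltn p (i j : nat) : (i < j)%N -> chomz p (i%:Z - j%:Z) = 0.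
Proof. by move=> lt_ij; rewrite (_ : _ - _ = Negz (j - i.+1)) // NegzE; lia. Qed.

(** Cut at e < l, the matrix factors as the Jacobi-Trudi matrix times the unitriangular matrix of
    the h_(i-j)(q), so the dependence on q disappears from the determinant. *)
Lemma det_jt_nilr lam l n p q :
  \det (jt lam [::] l (l + n) p q) = \det (jacobi_trudi lam l p).
Proof.
rewrite -(jt_wide p q (leq_addr n l)); last first.
  by move=> i j; rewrite nth_nil addn0 leqnn orbT.
pose U : 'M[K]_l := \matrix_(i, j) chomz q (i%:Z - j%:Z).
rewrite (_ : jt _ _ _ _ _ _ = jacobi_trudi lam l p *m U).
  rewrite det_mulmx [\det U]det_trig ?big1 ?mulr1 // => [i _|].
    by rewrite mxE subrr.
  by apply/is_trig_mxP => i j lt_ij; rewrite mxE chomz_ltn.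
apply/matrixP => i j; rewrite !mxE (reindex_inj rev_ord_inj) /=.
apply: eq_bigr => e _; rewrite !mxE nth_nil addr0.
have -> : l%:Z - 1 - (l - e.+1)%N%:Z = e by have := ltn_ord e; lia.
by [].
Qed.

Lemma det_jt_nill mu l n p q :
  \det (jt [::] mu l (l + n) p q) = \det (jacobi_trudi mu l q).
Proof. by rewrite -det_tr jt_tr det_jt_nilr. Qed.

Lemma det_jt_nil l n p q : \det (jt [::] [::] l (l + n) p q) = 1.
Proof.
rewrite det_jt_nilr -det_tr det_trig ?big1 // => [i _|].
  by rewrite !mxE nth_nil addr0 subrr.
by apply/is_trig_mxP => i j lt_ij; rewrite !mxE nth_nil addr0 chomz_ltn.
Qed.

Variables (xs ys : seq K) (d : int -> K).
Let g := locator ys.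
Let p := psum xs.
Let q := psum ys.
(** Here d stands for the coefficients of prod (1 - x t)^-1 prod (1 - y / t)^-1. Multiplying by prod
    (1 - y / t) leaves the series of the h_n(p), multiplying by prod (1 - x t) that of the h_n(q) in
    1 / t. The sign in [d (- j)] accounts for 1 / t. *)
Hypothesis actR : forall k, act g (fun j => d (- j)) k = chomz p (- k).
Hypothesis actL : forall k, act (locator xs) d k = chomz q (- k).

(** After inserting [actR] and exchanging sums, d (t + s) has the coefficient sum_f h_f(q) g_(s-f).
    For s < n this is a full convolution of a series with its inverse, so only d t survives; for s
    >= n the convolution is truncated, and these terms belong to later columns. *)
Lemma sum_chomz_toep n k (t : int) : (0 < n)%N -> (size ys <= k)%N ->
  \sum_(f < n) chom q f * chomz p (t + f%:Z) =
  d t + \sum_(c < k) d (t + n%:Z + c%:Z) * \sum_(f < n) chom q f * g`_(n + c - f).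
Proof.
move=> n0 le_ys.
have E (f : 'I_n) : chom q f * chomz p (t + f%:Z) =
    \sum_(s < n + k | (f <= s)%N) chom q f * (g`_(s - f) * d (t + s%:Z)).
  rewrite -mulr_sumr -[t + _]opprK -actR; congr (_ * _).
  rewrite (@act_wide _ _ _ _ (n + k - f)); last first.
    rewrite (leq_trans (size_locator _)) //.
    by apply: leq_ltn_trans le_ys _; have := ltn_ord f; lia.
  transitivity (\sum_(f <= s < n + k) g`_(s - f) * d (t + s%:Z)).
    rewrite -[X in index_iota X _]add0n big_addn big_mkord.
    by apply: eq_bigr => i _; rewrite addnK; congr (_ * d _); lia.
  by rewrite big_geq_mkord.
under eq_bigr do rewrite E.
rewrite (exchange_big_dep xpredT) //= big_split_ord /=; congr (_ + _).
  case: n n0 E => // n _ _; rewrite big_ord_recl /= [X in _ + X]big1 ?addr0.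
    under eq_bigr do rewrite mulrA.
    rewrite -mulr_suml.
    rewrite (_ : \sum_(i < n.+1 | _) _ = 1) ?mul1r //.
    rewrite (big_pred1 ord0) ?locator0 ?mulr1 // => i.
    by rewrite leqn0 /= -val_eqE.
  move=> s _; under eq_bigr do rewrite mulrA.
  rewrite -mulr_suml [X in X * _](_ : _ = 0) ?mul0r //.
  have lt_sn : (bump 0 s < n.+1)%N by have := ltn_ord s; rewrite /bump; lia.
  rewrite -[RHS](chom_locator_conv ys (bump 0 s)).
  by rewrite (big_ord_widen n.+1 (fun i => chom q i * g`_(bump 0 s - i))).
apply: eq_bigr => c _.
rewrite mulr_sumr; apply: eq_big => [f|f _].
  by have := ltn_ord f; lia.
by rewrite mulrA mulrC; congr (d _ * _); lia.
Qed.

(** The q-index in [jt] equals n - 1 - e, so only e < n contributes, and f = n - 1 - e. *)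
Lemma jt_entry lam mu l (i j : 'I_l) n :
  (n = l + nth 0 mu j - j)%N ->
  let t : int := (nth 0%N lam i)%:Z - (nth 0%N mu j)%:Z - i%:Z + j%:Z in
  jt lam mu l (l + (sumn lam + sumn mu)) p q i j =
  \sum_(f < n) chom q f * chomz p (t + f%:Z).
Proof.
move=> En t; rewrite mxE.
have lt_jl := ltn_ord j.
have le_mu := nth_le_sumn mu j.
have leL : (n <= l + (sumn lam + sumn mu))%N by lia.
rewrite -(subnKC leL) big_split_ord /= [X in _ + X]big1 ?addr0 => [|e _]; last first.
  rewrite [X in _ * chomz _ X](_ : _ = Negz e) ?mulr0 //.
  by rewrite NegzE; lia.
rewrite (reindex_inj rev_ord_inj) /=; apply: eq_bigr => f _.
have lt_fn := ltn_ord f.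
rewrite mulrC [X in chomz q X](_ : _ = f :> int); last by lia.
by congr (_ * chomz p _); rewrite /t; lia.
Qed.

(* Adding to the first l columns multiples of the last k ones, given by
   [sum_chomz_toep], makes the lower left block vanish. *)
Lemma det_toep_block lam mu l k :
  (size lam <= l)%N -> (size mu <= l)%N -> (size ys <= k)%N ->
  \det (toep lam mu d (l + k)) =
  \det (jt lam mu l (l + (sumn lam + sumn mu)) p q) * \det (toep [::] [::] d k).
Proof.
move=> szl szm szy.
pose n (j : 'I_l) := (l + nth 0 mu j - j)%N.
pose C : 'M[K]_(k, l) :=
  \matrix_(c, j) \sum_(f < n j) chom q f * g`_(n j + c - f).
have n0 j : (0 < n j)%N by rewrite /n; have := ltn_ord j; lia.
have E : toep lam mu d (l + k) *m block_mx 1%:M 0 C 1%:M =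
    block_mx (jt lam mu l (l + (sumn lam + sumn mu)) p q)
      (ursubmx (toep lam mu d (l + k))) 0 (toep [::] [::] d k).
  rewrite -{1}[toep _ _ _ _]submxK mulmx_block !mulmx1 !mulmx0 !add0r.
  congr block_mx; apply/matrixP => i j.
  - rewrite (jt_entry lam i (erefl (n j))) (sum_chomz_toep _ (n0 j) szy) !mxE.
    congr (_ + _); apply: eq_bigr => c _; rewrite !mxE; congr (d _ * _) => /=.
    rewrite [nth 0%N mu (l + c)]nth_default; last by lia.
    by have := ltn_ord j; rewrite /n; lia.
  - rewrite !mxE /= [nth 0%N lam _]nth_default; last by lia.
    pose t : int := - (nth 0%N mu j)%:Z - (l + i)%N%:Z + j%:Z.
    have lt_jl := ltn_ord j.
    transitivity (\sum_(f < n j) chom q f * chomz p (t + f%:Z)).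
      rewrite (sum_chomz_toep _ (n0 j) szy); congr (d _ + _); first by rewrite /t; lia.
      apply: eq_bigr => c _; rewrite !mxE; congr (d _ * _) => /=.
      rewrite ![nth 0%N _ (l + _)]nth_default; try by lia.
      by rewrite /t /n; lia.
    (* In these rows lam is zero and f < n j, so the p-index t + f is at most - i - 1. *)
    rewrite big1 // => f _; have lt_f := ltn_ord f.
    rewrite (_ : t + f%:Z = Negz (i + (n j - f.+1))) ?mulr0 //.
    by rewrite NegzE /t; move: lt_f; rewrite /n; lia.
  - by rewrite !mxE /= !nth_default //=; try lia; congr d; lia.
have : \det (toep lam mu d (l + k) *m block_mx 1%:M 0 C 1%:M) =
    \det (toep lam mu d (l + k)) by rewrite det_mulmx det_lblock !det1 !mulr1.
by move=> <-; rewrite E det_ublock.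
Qed.

(* If v kills the Toeplitz matrix, then u_j = sum_i v_i d_(j - i) vanishes for
   0 <= j < k by assumption and for j < 0 by the recurrence [actR], so the
   recurrence [actL] leaves a unitriangular system in v. *)
Lemma det_toep_neq0 k : (size ys <= k)%N -> \det (toep [::] [::] d k) != 0.
Proof.
move=> szy; apply/negP => /det0P[v v_neq0 vT]; case/negP: v_neq0.
pose u (j : int) := \sum_(i < k) v 0 i * d (j - i%:Z).
have u_pos (j : nat) : (j < k)%N -> u j = 0.
  move=> lt_jk; move/rowP: vT => /(_ (Ordinal lt_jk)).
  rewrite !mxE => E; rewrite -[RHS]E; apply: eq_bigr => i _.
  by rewrite mxE !nth_nil; congr (_ * d _) => /=; lia.
have act_sum e (w : int -> int -> K) m :
    act e (fun j => \sum_(i < k) v 0 i * w j i) m =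
    \sum_(i < k) v 0 i * act e (w ^~ i) m.
  rewrite /act.
  under [RHS]eq_bigr do rewrite mulr_sumr.
  rewrite exchange_big /=; apply: eq_bigr => c _.
  by rewrite mulr_sumr; apply: eq_bigr => i _; rewrite mulrCA.
have u_act m : act g (fun j => u (- j)) m = \sum_(i < k) v 0 i * chomz p (- m - i%:Z).
  rewrite /u (act_sum g (fun j i => d (- j - i))); apply: eq_bigr => i _.
  congr (_ * _); rewrite -[_ - _]opprK -actR; apply: eq_bigr => c _.
  by congr (_ * d _); rewrite !(opprD, opprK) addrAC.
have u_neg (m : nat) : u (- m%:Z) = 0.
  have u0 : u 0 = 0.
    have [k0|/u_pos//] := posnP k.
    by rewrite /u big1 // => -[i lt_ik]; exfalso; rewrite k0 in lt_ik.
  elim/ltn_ind: m => -[_|m IH]; first by rewrite oppr0.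
  have := u_act m.+1; rewrite [RHS]big1 => [|i _]; last first.
    rewrite [X in chomz _ X](_ : _ = Negz (m + i)) ?mulr0 //.
    by rewrite NegzE; lia.
  rewrite (act_wide _ _ (size_locator ys)) big_ord_recl locator0 mul1r subr0.
  rewrite big1 ?addr0 // => i _; have := ltn_ord i => lt_i.
  have [le_im|lt_mi] := leqP i m.
    rewrite (_ : - (_ - _) = - (m - i)%N%:Z); last by rewrite lift0; lia.
    by rewrite IH ?mulr0 // ltnS leq_subr.
  rewrite (_ : - (_ - _) = (i - m)%N%:Z); last by rewrite lift0; lia.
  by rewrite u_pos ?mulr0 //; apply: leq_ltn_trans (leq_subr _ _) (leq_trans lt_i szy).
pose T : 'M[K]_k := \matrix_(i, j) chomz q (i%:Z - j%:Z).
have vT0 : v *m T = 0.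
  apply/rowP => j; rewrite !mxE.
  transitivity (act (locator xs) u j).
    rewrite (act_sum (locator xs) (fun j i => d (j - i))); apply: eq_bigr => i _.
    rewrite mxE; congr (_ * _); rewrite -[_ - _ in LHS]opprB -actL.
    by apply: eq_bigr => c _; congr (_ * d _); rewrite addrAC.
  rewrite /act big1 // => c _.
  have [le_cj|lt_jc] := leqP c j.
    by rewrite subzn // u_pos ?mulr0 // (leq_ltn_trans (leq_subr _ _)).
  rewrite (_ : _ - _ = - (c - j)%N%:Z); last by lia.
  by rewrite u_neg mulr0.
have detT : \det T = 1.
  rewrite det_trig; last first.
    apply/is_trig_mxP => i j lt_ij; rewrite mxE.
    by rewrite (_ : _ - _ = Negz (j - i.+1)) // NegzE; lia.
  by rewrite big1 // => i _; rewrite mxE subrr.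
have: T \in unitmx by rewrite unitmxE detT unitr1.
by move=> uT; rewrite -(mulmxK uT v) vT0 mul0mx.
Qed.

(** Numerator and denominator share the nonzero factor [\det (toep [::] [::] d k)]; the remaining
    factor of the denominator is 1. *)
Lemma det_toep_ratio lam mu l n :
  (size lam <= l)%N -> (size mu <= l)%N -> (l + size ys <= n)%N ->
  \det (toep lam mu d n) / \det (toep [::] [::] d n) =
  \det (jt lam mu l (l + (sumn lam + sumn mu)) p q).
Proof.
move=> szl szm le_n.
have [k En] : exists k, n = (l + k)%N by exists (n - l)%N; lia.
rewrite {n}En in le_n *; have szy : (size ys <= k)%N by lia.
by rewrite !det_toep_block // det_jt_nil mul1r mulfK ?det_toep_neq0.
Qed.

End ToeplitzDeterminant.

(** * Jacobi-Trudi matrices with finitely many variables added *)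

Section VandermondeJacobiTrudi.
Variable K : fieldType.
Hypothesis natU : forall n, (n.+1%:R : K) \is a GRing.unit.
Implicit Types (p : nat -> K) (ts : seq K).

Lemma act_locator_add ts p p' : (forall k, (0 < k)%N -> p' k = p k + psum ts k) ->
  forall k, act (locator ts) (chomz p') k = chomz p k.
Proof.
elim: ts p' => [|x ts IH] p' pp' k.
  rewrite /locator big_nil act1; case: k => // n; apply: (eq_chom natU) => j /andP[j0 _].
  by rewrite pp' // /psum big_nil addr0.
rewrite locator_cons mulrC actM.
rewrite -(IH (fun j => p j + psum ts j)) //; apply: eq_act => j.
rewrite act_lin; apply: (chom_pow_recl natU) => n n0.
by rewrite pp' // -addrA; congr (_ + _); rewrite /psum big_cons addrC.
Qed.

(** The factor 1 / (1 - x t) expanded as a geometric series; for k < L all omitted terms have a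
    negative index. *)
Lemma chomz_pow_series x p p' : (forall k, (0 < k)%N -> p' k = p k + x ^+ k) ->
  forall L (k : int), k < L%:Z -> chomz p' k = \sum_(e < L) chomz p (k - e%:Z) * x ^+ e.
Proof.
move=> pp'; elim=> [|L IH] k lt_kL.
  by rewrite big_ord0; case: k lt_kL.
have := chom_pow_recl natU pp' k => /eqP; rewrite subr_eq => /eqP ->.
rewrite big_ord_recl subr0 mulr1; congr (_ + _).
rewrite IH; last by lia.
rewrite mulr_sumr; apply: eq_bigr => e _.
rewrite lift0 exprS mulrCA; congr (_ * _); congr (chomz p _); lia.
Qed.

(* Combining the columns of the Jacobi-Trudi matrix at p' with the coefficients of
   prod_(s <> r) (1 - t_s X) leaves only the variable t_r in the r-th column; the
   case p = 0, lam empty identifies the determinant of the column operation. *)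
Lemma vandermonde_jacobi_trudi lam l n (t : 'I_l -> K) p p' :
  (forall k, (0 < k)%N -> p' k = p k + \sum_(r < l) t r ^+ k) ->
  \det (\matrix_(c < l, r < l) t r ^+ (l - c.+1)) * \det (jacobi_trudi lam l p') =
  \det (\matrix_(i < l, r < l) \sum_(e < l + (sumn lam + n))
     chomz p (l%:Z - 1 - e%:Z - i%:Z + (nth 0%N lam i)%:Z) * t r ^+ e).
Proof.
pose E (r : 'I_l) := locator [seq t s | s <- enum 'I_l & s != r].
pose eps : 'M[K]_l := \matrix_(c, r) (E r)`_(l - c.+1).
(* General in the partition and the sequences because it serves twice: for the claim and for the
   determinant of [eps]. *)
have mulE (lam' : seq nat) n' p1 p2 :
    (forall k, (0 < k)%N -> p2 k = p1 k + \sum_(r < l) t r ^+ k) ->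
    jacobi_trudi lam' l p2 *m eps = \matrix_(i < l, r < l)
      \sum_(e < l + (sumn lam' + n'))
      chomz p1 (l%:Z - 1 - e%:Z - i%:Z + (nth 0%N lam' i)%:Z) * t r ^+ e.
  move=> Ep; apply/matrixP => i r; rewrite !mxE.
  have szE : (size (E r) <= l)%N.
    rewrite (leq_trans (size_locator _)) // size_map size_filter.
    have := count_predC (fun s => s != r) (enum 'I_l); rewrite size_enum_ord => El.
    have : (0 < count (predC (fun s => s != r)) (enum 'I_l))%N.
      by rewrite -has_count; apply/hasP; exists r; rewrite ?mem_enum //= negbK.
    by move=> c0; rewrite -[X in (_ <= X)%N]El -addn1 leq_add2l.
  pose k : int := l%:Z - 1 - i%:Z + (nth 0%N lam' i)%:Z.
  transitivity (act (E r) (chomz p2) k).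
    rewrite (act_wide _ _ szE) (reindex_inj rev_ord_inj) /=; apply: eq_bigr => c _.
    have lt_cl := ltn_ord c.
    rewrite !mxE (_ : (l - (l - c.+1).+1)%N = c); last by lia.
    by rewrite mulrC; congr (_ * chomz _ _); rewrite /k /=; lia.
  rewrite (act_locator_add (p := fun j => p1 j + t r ^+ j)) => [|j j0]; last first.
    rewrite Ep // (bigD1 r) //= addrA; congr (_ + _).
    by rewrite /psum big_map big_filter big_enum_cond.
  rewrite (@chomz_pow_series (t r) p1 _ _ (l + (sumn lam' + n'))) //; last first.
    by rewrite /k; have := nth_le_sumn lam' i; have := ltn_ord i; lia.
  by apply: eq_bigr => e _; congr (chomz p1 _ * _); rewrite /k; lia.
move=> Ep; rewrite -(mulE lam n p p' Ep) det_mulmx mulrC; congr (_ * _).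
pose z := psum [::] : nat -> K.
have Ez : forall k, (0 < k)%N -> psum [seq t r | r <- enum 'I_l] k =
    z k + \sum_(r < l) t r ^+ k.
  by move=> k _; rewrite /psum big_map big_enum /z /psum big_nil add0r.
rewrite -[RHS]mul1r -(det_jt_nil l 0 (psum [seq t r | r <- enum 'I_l]) z).
rewrite det_jt_nilr // -det_mulmx (mulE [::] 0%N z _ Ez).
congr (\det _); apply/matrixP => i r; rewrite !mxE.
have lt_i : (l - i.+1 < l + (sumn [::] + 0))%N by have := ltn_ord i; rewrite /=; lia.
(* For the empty list of variables h_k is zero unless k = 0, so only e = l - 1 - i survives. *)
rewrite (bigD1 (Ordinal lt_i)) //= big1 => [|e ne_e].
  rewrite addr0 nth_nil [X in chomz z X](_ : _ = 0) ?mul1r //.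
  by have := ltn_ord i; lia.
rewrite nth_nil (chomz0 natU) [X in (nat_of_bool X)%:R](_ : _ = false) ?mul0r //.
apply: contraNF ne_e => /eqP E0; apply/eqP/val_inj => /=.
by have := ltn_ord i; lia.
Qed.

End VandermondeJacobiTrudi.

(** * Density of power sums *)

Section Density.
Variable K : numFieldType.
Implicit Types (p u : nat -> K) (f : (nat -> K) -> K).

Lemma natr_unit n : (n.+1%:R : K) \is a GRing.unit.
Proof. by rewrite unitfE pnatr_eq0. Qed.

Lemma poly_nat_roots (G : {poly K}) : (forall n : nat, G.[n%:R] = 0) -> G = 0.
Proof.
move=> G0; apply: (@roots_geq_poly_eq0 _ _ [seq n%:R | n <- iota 0 (size G)]).
- by apply/allP => x /mapP[n _ ->]; apply/rootP.
- by rewrite map_inj_uniq ?iota_uniq //; apply: mulrIn; rewrite oner_neq0.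
- by rewrite size_map size_iota.
Qed.

(** Polynomiality in infinitely many coordinates, required only along affine lines: the density
    argument varies the weight of one point at a time. *)
Definition line_poly f := forall p u,
  exists G : {poly K}, forall s, f (fun k => p k + s * u k) = G.[s].

Lemma line_polyC c : line_poly (fun=> c).
Proof. by move=> p u; exists c%:P => s; rewrite hornerC. Qed.

Lemma line_poly_coord n : line_poly (fun p => p n).
Proof.
by move=> p u; exists ((p n)%:P + (u n) *: 'X) => s; rewrite !hornerE mulrC.
Qed.

Lemma line_polyD f g : line_poly f -> line_poly g -> line_poly (fun p => f p + g p).
Proof.
move=> Pf Pg p u; have [F EF] := Pf p u; have [G EG] := Pg p u.
by exists (F + G) => s; rewrite hornerD EF EG.
Qed.

Lemma line_polyM f g : line_poly f -> line_poly g -> line_poly (fun p => f p * g p).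
Proof.
move=> Pf Pg p u; have [F EF] := Pf p u; have [G EG] := Pg p u.
by exists (F * G) => s; rewrite hornerM EF EG.
Qed.

Lemma line_poly_sum (I : Type) (r : seq I) (P : pred I) (F : I -> (nat -> K) -> K) :
  (forall i, line_poly (F i)) -> line_poly (fun p => \sum_(i <- r | P i) F i p).
Proof.
move=> PF; elim: r => [|i r IH].
  by move=> p u; exists 0 => s; rewrite big_nil horner0.
have [Pi|nPi] := boolP (P i).
  move=> p u; have [G EG] := line_polyD (PF i) IH p u.
  by exists G => s; rewrite big_cons Pi EG.
move=> p u; have [G EG] := IH p u.
by exists G => s; rewrite big_cons (negbTE nPi) EG.
Qed.

Lemma line_poly_prod (I : Type) (r : seq I) (P : pred I) (F : I -> (nat -> K) -> K) :
  (forall i, line_poly (F i)) -> line_poly (fun p => \prod_(i <- r | P i) F i p).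
Proof.
move=> PF; elim: r => [|i r IH].
  by move=> p u; exists 1 => s; rewrite big_nil hornerC.
have [Pi|nPi] := boolP (P i).
  move=> p u; have [G EG] := line_polyM (PF i) IH p u.
  by exists G => s; rewrite big_cons Pi EG.
move=> p u; have [G EG] := IH p u.
by exists G => s; rewrite big_cons (negbTE nPi) EG.
Qed.

Lemma line_poly_det n (A : (nat -> K) -> 'M[K]_n) :
  (forall i j, line_poly (fun p => A p i j)) -> line_poly (fun p => \det (A p)).
Proof.
move=> PA; apply: line_poly_sum => s; apply: line_polyM; first exact: line_polyC.
exact: line_poly_prod.
Qed.

Lemma line_poly_chom n : line_poly (fun p => chom p n).
Proof.
elim/ltn_ind: n => -[_|n IH]; first exact: line_polyC.
have : line_poly (fun p => n.+1%:R^-1 * \sum_(k < n.+1) p k.+1 * chom p (n - k)).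
  apply/line_polyM/line_poly_sum => [|k]; first exact: line_polyC.
  by apply: line_polyM; [exact: line_poly_coord | apply: IH; rewrite ltnS leq_subr].
move=> H p u; have [G EG] := H p u; exists G => s.
by rewrite -EG -(chomS natr_unit) mulKf ?pnatr_eq0.
Qed.

Lemma line_poly_chomz k : line_poly (fun p => chomz p k).
Proof. by case: k => n; [exact: line_poly_chom | exact: line_polyC]. Qed.

Variables (good : pred K) (x_ : nat -> K).
Hypotheses (x_inj : injective x_) (x_neq0 : forall n, x_ n != 0).
Hypothesis x_good : forall n, good (x_ n).

(* A general sequence agrees in degrees 1..M with the power sums of the x_i taken
   with complex weights (Vandermonde); natural number weights are realised by
   repeating the x_i. *)
Lemma psum_dense f M : line_poly f ->
  (forall p p', (forall k, (0 < k <= M)%N -> p k = p' k) -> f p = f p') ->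
  (forall xs, all good xs -> f (psum xs) = 0) -> forall p, f p = 0.
Proof.
move=> Pf f_ext f0 p.
(* Induction on the number of points with arbitrary weights. If the weight s is a natural number,
   the point amounts to s copies of x moved into [xs]; a polynomial in s vanishing at all natural
   numbers is zero. *)
have weighted (ws : seq (K * K)) xs : all (fun w => good w.2) ws -> all good xs ->
    f (fun k => \sum_(w <- ws) w.1 * w.2 ^+ k + psum xs k) = 0.
  elim: ws xs => [|[s x] ws IH] xs /=.
    by move=> _ gxs; rewrite -[RHS](f0 xs) //; apply: f_ext => k _; rewrite big_nil add0r.
  move=> /andP[gx gws] gxs.
  have [G EG] := Pf (fun k => \sum_(w <- ws) w.1 * w.2 ^+ k + psum xs k) (fun k => x ^+ k).
  have G0 : G = 0.
    apply: poly_nat_roots => n; rewrite -EG -[RHS](IH (nseq n x ++ xs) gws); last first.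
      by rewrite all_cat gxs all_nseq gx orbT.
    apply: f_ext => k _; rewrite -addrA; congr (_ + _).
    by rewrite /psum big_cat /= big_nseq addrC; congr (_ + _); rewrite iter_addr addr0 mulr_natl.
  rewrite -[RHS](horner0 s) -G0 -EG; apply: f_ext => k _.
  by rewrite big_cons /= -addrA addrC.
pose a : 'rV[K]_M := \row_i x_ i.
have uV : Vandermonde M a \in unitmx.
  rewrite unitmxE unitfE det_Vandermonde; apply/prodf_neq0 => i _.
  apply/prodf_neq0 => j lt_ij; rewrite !mxE subr_eq0 (inj_eq x_inj).
  by rewrite neq_ltn lt_ij orbT.
pose c : 'cV[K]_M := invmx (Vandermonde M a) *m \col_i p i.+1.
have Ec : Vandermonde M a *m c = \col_i p i.+1 by rewrite mulKVmx.
(* The Vandermonde rows start with the exponent 0 and the power sums with 1; dividing the weights by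
   x_i makes up for the difference. *)
pose ws := [seq (c i 0 / x_ i, x_ i) | i <- enum 'I_M].
rewrite -[RHS](weighted ws [::]) //; last first.
  by rewrite all_map; apply/allP => i _ /=.
apply: f_ext => -[//|k] /andP[_ le_kM].
have /matrixP/(_ (Ordinal le_kM) 0) := Ec; rewrite !mxE /= => <-.
rewrite /psum big_nil addr0 big_map big_enum /=; apply: eq_bigr => i _.
by rewrite !mxE exprS mulrA divfK // mulrC.
Qed.

End Density.

(** * The operator Delta *)

Section MultivariatePolynomials.
Variable K : numFieldType.

(** A column of the inverse Vandermonde matrix on 0, ..., B - 1 reads off one coefficient of a
    univariate polynomial of degree < B from its values. Products of such functionals, one per
    variable, read off the coefficient of [m] from the values on a grid; B exceeds all exponents in
    P and [m]. *)
Lemma mpoly_grid_eq0 n (P : mpoly n K) : (forall v, meval v P = 0) -> P = 0.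
Proof.
move=> P0; apply/mpolyP => m; rewrite mcoeff0.
pose B := (mmeasure mdeg P + mdeg m).+1.
pose a : 'rV[K]_B := \row_i i%:R.
have uV : Vandermonde B a \in unitmx.
  rewrite unitmxE unitfE det_Vandermonde; apply/prodf_neq0 => i _.
  apply/prodf_neq0 => j lt_ij; rewrite !mxE subr_eq0 eqr_nat.
  by rewrite neq_ltn lt_ij orbT.
pose W := invmx (Vandermonde B a).
have le_mdeg (m' : multinom n) i : (m' i <= mdeg m')%N.
  by rewrite mdegE (bigD1 i) //= leq_addr.
have W_dual (j k : nat) : (j < B)%N -> (k < B)%N ->
    \sum_(c < B) W c (inord j) * (c%:R : K) ^+ k = (k == j)%:R.
  move=> ltj ltk; have /matrixP/(_ (inord k) (inord j)) := mulmxV uV.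
  rewrite !mxE -val_eqE /= !inordK // => <-; apply: eq_bigr => c _.
  by rewrite !mxE inordK // mulrC.
have : \sum_(c : {ffun 'I_n -> 'I_B}) (\prod_i W (c i) (inord (m i))) *
    meval (fun i => (c i)%:R) P = 0.
  by rewrite big1 // => c _; rewrite P0 mulr0.
under eq_bigr do rewrite mevalE mulr_sumr.
rewrite exchange_big /=.
under eq_big_seq => m' m'P.
  under eq_bigr do rewrite mulrCA -big_split /=.
  rewrite -mulr_sumr.
  rewrite -(bigA_distr_bigA (fun i c => W c (inord (m i)) * (c%:R : K) ^+ m' i)).
  under eq_bigr => i _.
    rewrite W_dual; last 2 first.
    - by rewrite ltnS (leq_trans (le_mdeg m i)) // leq_addl.
    - rewrite ltnS (leq_trans (le_mdeg m' i)) // ltnW //.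
      by rewrite ltn_addr // mmeasure_mnm_lt.
    over.
  rewrite /= (_ : \prod_(i < n) _ = (m' == m)%:R); last first.
    have [->|ne_m] := eqVneq m' m; first by rewrite big1 // => i _; rewrite eqxx.
    have /existsP[i ne_mi] : [exists i, m' i != m i].
      apply: contraNT ne_m => /existsPn eq_m.
      by apply/eqP/mnmP => i; apply/eqP/negPn.
    by rewrite (bigD1 i) //= (negbTE ne_mi) mul0r.
  over.
rewrite /= => E; have [mP|/memN_msupp_eq0//] := boolP (m \in msupp P).
rewrite -[RHS]E (bigD1_seq m) ?msupp_uniq //= eqxx mulr1 big1 ?addr0 // => m' /negbTE->.
by rewrite mulr0.
Qed.

Section SeparateVariables.
Variable l : nat.

Definition in_var (r : 'I_l) (u : {poly K}) : mpoly l K :=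
  \sum_(e < size u) mpolyC l u`_e * mpolyX K (mnm1 r) ^+ e.

Lemma in_var_wide r (u : {poly K}) n : (size u <= n)%N ->
  in_var r u = \sum_(e < n) mpolyC l u`_e * mpolyX K (mnm1 r) ^+ e.
Proof.
move=> le_un; rewrite /in_var.
rewrite (big_ord_widen n (fun e => mpolyC l u`_e * mpolyX K (mnm1 r) ^+ e)) //.
rewrite big_mkcond; apply: eq_bigr => e _; case: ifPn => //.
by rewrite -leqNgt => le_ue; rewrite nth_default // mpolyC0 mul0r.
Qed.

Lemma in_varE r u : in_var r u = (map_poly (@mpolyC l K) u).[mpolyX K (mnm1 r)].
Proof.
rewrite (@horner_coef_wide _ (size u)) ?size_poly //.
by apply: eq_bigr => e _; rewrite coef_map.
Qed.

Lemma in_varM r u v : in_var r (u * v) = in_var r u * in_var r v.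
Proof. by rewrite !in_varE rmorphM hornerM. Qed.

(** Every factor has its own variable, so a monomial of the expanded product arises in exactly one
    way. *)
Lemma mcoeff_prod_in_var (u : 'I_l -> {poly K}) (m : multinom l) :
  mcoeff m (\prod_r in_var r (u r)) = \prod_r (u r)`_(m r).
Proof.
pose B := (\max_r size (u r) + mdeg m).+1.
have le_B r : (size (u r) <= B)%N.
  by rewrite ltnW // ltnS (leq_trans (@leq_bigmax _ (fun r => size (u r)) r)) // leq_addr.
have lt_mB r : (m r < B)%N.
  by rewrite ltnS (leq_trans _ (leq_addl _ _)) // mdegE (bigD1 r) //= leq_addr.
under eq_bigr do rewrite (in_var_wide _ (le_B _)).
rewrite bigA_distr_bigA /= raddf_sum /=.
have term (c : {ffun 'I_l -> 'I_B}) :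
    mcoeff m (\prod_r (mpolyC l (u r)`_(c r) * mpolyX K (mnm1 r) ^+ c r)) =
    \prod_r (u r)`_(c r) * [forall r, c r == m r :> nat]%:R.
  rewrite big_split /= -rmorph_prod /= mcoeffCM; congr (_ * _).
  pose n : multinom l := Multinom (mktuple (fun r => c r : nat)).
  have -> : \prod_r mpolyX K (mnm1 r) ^+ c r = mpolyX K n.
    by rewrite mpolyXE_id; apply: eq_bigr => r _; rewrite mnmE.
  rewrite mcoeffX; congr (nat_of_bool _)%:R; apply/eqP/forallP => [<- r|E].
    by rewrite mnmE.
  by apply/mnmP => r; rewrite mnmE; apply/eqP.
under eq_bigr do rewrite term.
rewrite (bigD1 [ffun r => inord (m r)]) //= [X in _ + X]big1 ?addr0.
  rewrite (_ : [forall r, _]) ?mulr1; last by apply/forallP => r; rewrite ffunE inordK.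
  by apply: eq_bigr => r _; rewrite ffunE inordK.
move=> c ne_c; rewrite (_ : [forall r, _] = false) ?mulr0 //.
apply: contraNF ne_c => /forallP E; apply/eqP/ffunP => r.
by apply/val_inj; rewrite /= ffunE inordK //; apply/eqP.
Qed.

(* Coefficient extraction at an integer exponent, zero as soon as one of the
   exponents is negative. *)
Definition zcoeff (n : 'I_l -> int) (g : mpoly l K) : K :=
  if [forall r, 0 <= n r] then
    mcoeff (Multinom (mktuple (fun r => `|n r|%N))) g
  else 0.

Lemma zcoeff_is_linear n : linear_for *%R (zcoeff n).
Proof.
move=> c g1 g2; rewrite /zcoeff; case: ifP => _; last by rewrite mulr0 addr0.
by rewrite mcoeffD mcoeffZ.
Qed.

HB.instance Definition _ n :=
  GRing.isLinear.Build K (mpoly l K) K *%R (zcoeff n) (zcoeff_is_linear n).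

Lemma zcoeffZ n c g : zcoeff n (c *: g) = c * zcoeff n g.
Proof. exact: linearZ. Qed.

Lemma eq_zcoeff n n' g : n =1 n' -> zcoeff n g = zcoeff n' g.
Proof.
move=> E; rewrite /zcoeff (eq_forallb (fun r => congr1 _ (E r))).
by case: ifP => // _; congr (mcoeff _ g); apply/mnmP => r; rewrite !mnmE E.
Qed.

Lemma mcoeff_mulX (m n : multinom l) (g : mpoly l K) :
  mcoeff n (mpolyX K m * g) =
  if [forall r, m r <= n r]%N then mcoeff (mnm_sub n m) g else 0.
Proof.
rewrite {1}[g]mpolyE mulr_sumr raddf_sum /=.
under eq_bigr do rewrite -scalerAr -mpolyXD mcoeffZ mcoeffX.
case: ifPn => [/forallP le_mn|/forallPn[r ngt]]; last first.
  rewrite big1 // => k _; rewrite (_ : _ == n = false) ?mulr0 //.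
  by apply: contraNF ngt => /eqP <-; rewrite mnmDE leq_addr.
have E k : (mnm_add m k == n) = (k == mnm_sub n m).
  apply/eqP/eqP => [<-|->]; apply/mnmP => r; rewrite !(mnmDE, mnmBE).
    by rewrite addKn.
  by rewrite subnKC.
under eq_bigr do rewrite E.
have [kP|nkP] := boolP (mnm_sub n m \in msupp g).
  rewrite (bigD1_seq (mnm_sub n m)) ?msupp_uniq //= eqxx mulr1 big1 ?addr0 // => k /negbTE->.
  by rewrite mulr0.
rewrite (memN_msupp_eq0 nkP) big_seq big1 // => k kg.
by rewrite (_ : k == _ = false) ?mulr0 //; apply: contraNF nkP => /eqP <-.
Qed.

(** With integer exponents a monomial factor is always a plain shift. The value zero at negative
    exponents matches h_n = 0 for n < 0. *)
Lemma zcoeff_mulX n (m : multinom l) g :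
  zcoeff n (mpolyX K m * g) = zcoeff (fun r => n r - (m r)%:Z) g.
Proof.
rewrite /zcoeff; case: ifPn => [/forallP n0|/forallPn[r nr]]; last first.
  case: ifPn => // /forallP/(_ r); rewrite subr_ge0 => /(le_trans _) H.
  by case/negP: nr; apply: H.
rewrite mcoeff_mulX.
have E : [forall r, (m r <= Multinom (mktuple (fun r => `|n r|%N)) r)%N] =
    [forall r, 0 <= n r - (m r)%:Z].
  by apply: eq_forallb => r; rewrite mnmE; have := n0 r; lia.
rewrite E; case: ifPn => // /forallP le_mn; congr (mcoeff _ g); apply/mnmP => r.
by rewrite !mnmE; have := n0 r; have := le_mn r; lia.
Qed.

Lemma zcoeff_prod_in_var n (u : 'I_l -> {poly K}) :
  zcoeff n (\prod_r in_var r (u r)) =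
  \prod_r (if 0 <= n r then (u r)`_(`|n r|) else 0).
Proof.
rewrite /zcoeff; case: ifPn => [/forallP n0|/forallPn[r nr]].
  by rewrite mcoeff_prod_in_var; apply: eq_bigr => r _; rewrite n0 mnmE.
by rewrite (bigD1 r) //= (negbTE nr) mul0r.
Qed.

End SeparateVariables.
End MultivariatePolynomials.

(** * The commutator of Delta with multiplication by p_k *)

Section DeltaOperator.
Variable N : nat.
Local Notation QX := (mpoly (N + N) rat).
Local Notation W := (@weighted_laplacian N).
Implicit Types (P Q B F G : QX) (k : 'I_N).

Definition xp k : QX := mpolyX rat (mnm1 (lshift N k)).
Definition dp k P : QX := mderiv (lshift N k) P.
Definition dq k P : QX := mderiv (rshift N k) P.

Lemma laplacian_is_linear : linear W.
Proof.
move=> c P Q; rewrite /W scaler_sumr -big_split; apply: eq_bigr => k _ /=.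
by rewrite !(mderivD, mderivZ) scalerDr !scalerA mulrC.
Qed.

HB.instance Definition _ := GRing.isLinear.Build rat QX QX _ W laplacian_is_linear.

Lemma iter_laplacian_linear j : linear (iter j W).
Proof. by elim: j => // j IH c P Q; rewrite !iterS IH linearP. Qed.

Lemma msize_mderiv n (i : 'I_n) (P : mpoly n rat) :
  (mmeasure mdeg (mderiv i P) <= (mmeasure mdeg P).-1)%N.
Proof.
rewrite {1}mmeasureE; apply/bigmax_leqP_seq => m mP _; move: mP.
rewrite mcoeff_msupp mcoeff_deriv => nz.
have : mnm_add m (mnm1 i) \in msupp P.
  by rewrite mcoeff_msupp; apply: contraNneq nz => ->; rewrite mul0rn.
by move=> /msize_mdeg_lt; rewrite mdegD mdeg1 addn1; case: (mmeasure _ _).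
Qed.

Lemma msize_laplacian P : (mmeasure mdeg (W P) <= (mmeasure mdeg P).-1)%N.
Proof.
rewrite (leq_trans (mmeasure_sum _ _ _ _)) //; apply/bigmax_leqP => k _.
rewrite (leq_trans (msizeZ_le _ _)) // (leq_trans (msize_mderiv _ _)) //.
by rewrite (leq_trans (leq_pred _)) // msize_mderiv.
Qed.

Lemma iter_laplacian_eq0 P j : (mmeasure mdeg P <= j)%N -> iter j W P = 0.
Proof.
elim: j P => [|j IH] P; first by rewrite leqn0 mmeasure_poly_eq0 => /eqP.
by move=> le_Pj; rewrite iterSr IH // (leq_trans (msize_laplacian P)) //; lia.
Qed.

(** The number of terms in [Delta] depends on its argument; comparing values at different
    polynomials needs a common cutoff. *)
Lemma Delta_wide P J : (mmeasure mdeg P <= J)%N ->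
  Delta P = \sum_(j < J) ((j : nat)`!%:R : rat)^-1 *: iter j W P.
Proof.
move=> le_PJ; rewrite /Delta.
rewrite (big_ord_widen J (fun j => (j`!%:R : rat)^-1 *: iter j W P)) //.
rewrite big_mkcond; apply: eq_bigr => j _; case: ifPn => //.
by rewrite -leqNgt => le_Pj; rewrite iter_laplacian_eq0 // scaler0.
Qed.

Lemma Delta_is_linear : linear (@Delta N).
Proof.
move=> c P Q.
have [J [leJ1 leJ2 leJ3]] : exists J, [/\ (mmeasure mdeg (c *: P + Q) <= J)%N,
    (mmeasure mdeg P <= J)%N & (mmeasure mdeg Q <= J)%N].
  exists (mmeasure mdeg (c *: P + Q) + mmeasure mdeg P + mmeasure mdeg Q)%N.
  by split; lia.
rewrite (Delta_wide leJ1) (Delta_wide leJ2) (Delta_wide leJ3).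
rewrite scaler_sumr -big_split; apply: eq_bigr => j _ /=.
by rewrite iter_laplacian_linear scalerDr !scalerA mulrC.
Qed.

HB.instance Definition _ := GRing.isLinear.Build rat QX QX _ (@Delta N) Delta_is_linear.

Lemma laplacian_dq k P : W (dq k P) = dq k (W P).
Proof.
rewrite /W /dq raddf_sum; apply: eq_bigr => i _ /=.
rewrite mderivZ; congr (_ *: _).
by rewrite -(mderiv_comm (rshift N i)) (mderiv_comm (lshift N i)).
Qed.

Lemma mderiv_xp v k :
  mderiv v (xp k) = (v == lshift N k)%:R.
Proof.
rewrite mderivX mnm1E eq_sym; have [->|_] := eqVneq; last by rewrite scale0r.
rewrite scale1r (_ : mnm_sub _ _ = mnm0) ?mpolyX0 //.
by apply/mnmP => i; rewrite mnmBE subnn mnmE.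
Qed.

Lemma laplacian_xpM k P : W (xp k * P) = xp k * W P + k.+1%:R *: dq k P.
Proof.
have term (i : 'I_N) : i.+1%:R *: mderiv (lshift N i) (mderiv (rshift N i) (xp k * P)) =
    xp k * (i.+1%:R *: mderiv (lshift N i) (mderiv (rshift N i) P)) +
    (if i == k then k.+1%:R *: dq k P else 0).
  rewrite !mderivM !mderiv_xp eq_rlshift mul0r add0r mderivM mderiv_xp.
  rewrite (inj_eq (@lshift_inj _ _)) scalerDr addrC scalerAr; congr (_ + _).
  by have [->|_] := eqVneq; rewrite ?mul1r // mul0r scaler0.
rewrite /W; under eq_bigr do rewrite term.
by rewrite big_split /= -mulr_sumr -big_mkcond /= big_pred1_eq.
Qed.

Lemma iter_laplacian_dq j k P : iter j W (dq k P) = dq k (iter j W P).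
Proof. by elim: j => // j IH; rewrite !iterS IH laplacian_dq. Qed.

(** The commutator of [W] with multiplication by the variable is a multiple of [dq k], which
    commutes with [W]; so the power j + 1 collects it j + 1 times. *)
Lemma iter_laplacian_xpM j k P :
  iter j.+1 W (xp k * P) =
  xp k * iter j.+1 W P + (j.+1%:R * k.+1%:R) *: iter j W (dq k P).
Proof.
elim: j => [|j IH]; first by rewrite mul1r /= laplacian_xpM.
rewrite iterS IH linearD linearZ /= laplacian_xpM -addrA; congr (_ + _).
rewrite -iterS -[in RHS]natr1 mulrDl mul1r scalerDl addrC; congr (_ + _).
by rewrite -iterS iter_laplacian_dq.
Qed.

Lemma Delta_xpM k P : Delta (xp k * P) = xp k * Delta P + k.+1%:R *: Delta (dq k P).
Proof.
(* Cutoffs J + 1 and J: the commutator part of the term j + 1 becomes the term j of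
   [Delta (dq k P)], as (j + 1) / (j + 1)! = 1 / j!. *)
have [J [leJ1 leJ2 leJ3]] : exists J, [/\ (mmeasure mdeg (xp k * P) <= J.+1)%N,
    (mmeasure mdeg P <= J.+1)%N & (mmeasure mdeg (dq k P) <= J)%N].
  exists (mmeasure mdeg (xp k * P) + mmeasure mdeg P + mmeasure mdeg (dq k P))%N.
  by split; lia.
rewrite (Delta_wide leJ1) (Delta_wide leJ2) (Delta_wide leJ3).
rewrite !big_ord_recl /= mulrDr -scalerAr -addrA; congr (_ + _).
rewrite mulr_sumr scaler_sumr -big_split; apply: eq_bigr => j _ /=.
rewrite -iterS iter_laplacian_xpM scalerDr scalerAr; congr (_ + _).
rewrite !scalerA; congr (_ *: _).
rewrite /bump leq0n add1n factS natrM invfM.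
have nz : (j.+1%:R : rat) != 0 by rewrite pnatr_eq0.
by rewrite mulrACA mulVf // mul1r mulrC.
Qed.

Lemma Delta_dp0 B : (forall k, dp k B = 0) -> Delta B = B.
Proof.
move=> B0.
have WB : W B = 0.
  rewrite /W big1 // => k _; rewrite mderiv_comm [X in mderiv _ X]B0.
  by rewrite mderiv0 scaler0.
rewrite (@Delta_wide B (mmeasure mdeg B).+1) // big_ord_recl /= invr1 scale1r.
rewrite big1 ?addr0 // => j _; rewrite -iterS iterSr WB.
by rewrite iter_laplacian_eq0 ?scaler0 // mmeasure0.
Qed.

Lemma natr_mpoly_unit n : (n.+1%:R : QX) \is a GRing.unit.
Proof.
apply/unitrPr; exists (mpolyC _ n.+1%:R^-1).
by rewrite -mpolyC_nat -mpolyCM mulfV ?mpolyC1 // pnatr_eq0.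
Qed.

(** The generic sequence p_1, ..., p_N, 0, 0, ..., in the form that [chom] takes as input; [j.-1]
    undoes the shift between index and ordinal. *)
Definition pvar (j : nat) : QX :=
  if insub j.-1 is Some k then xp k else 0.

Definition qvar (j : nat) : QX :=
  if insub j.-1 is Some k then mpolyX rat (mnm1 (rshift N k)) else 0.

(** As [chom] divides by n + 1, the derivative is taken of (n + 1) h_(n+1), where Newton's identity
    applies. *)
Lemma mderiv_chom0 v (x : nat -> QX) n :
  (forall j, mderiv v (x j) = 0) -> mderiv v (chom x n) = 0.
Proof.
move=> vx; elim/ltn_ind: n => -[_|n IH]; first by rewrite chom0 -mpolyC1 mderivC.
apply: (mulrI (natr_mpoly_unit n)); rewrite mulr0.
rewrite -[LHS]add0r -[X in X + _](mul0r (chom x n.+1)).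
rewrite -[X in X * _ + _](mderivC v (n.+1%:R : rat)) mpolyC_nat -mderivM.
rewrite (chomS natr_mpoly_unit) raddf_sum big1 //= => k _.
by rewrite mderivM vx IH ?ltnS ?leq_subr // mul0r mulr0 addr0.
Qed.

Lemma mderiv_natM v n P : mderiv v (n%:R * P) = n%:R * mderiv v P.
Proof. by rewrite -mpolyC_nat mderiv_mulC. Qed.

Lemma dp_qvar k n : dp k (chomz qvar n) = 0.
Proof.
case: n => n; last exact: mderiv0.
apply: mderiv_chom0 => j; rewrite /qvar; case: insub => [i|]; last exact: mderiv0.
rewrite mderivX mnm1E eq_sym eq_lrshift scale0r //.
Qed.

(** Differentiate Newton's identity for (n + 1) h_(n+1). The term with the differentiated variable
    gives (k + 1) h_(n-k); by induction the others form Newton's sum for (n - k) h_(n-k); together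
    they are (n + 1) h_(n-k). *)
Lemma dq_qvar k n : k.+1%:R *: dq k (chomz qvar n) = chomz qvar (n - k.+1%:Z).
Proof.
case: n => n; last by rewrite /dq mderiv0 scaler0.
have dq_var j : dq k (qvar j.+1) = (j == k :> nat)%:R.
  rewrite /dq /qvar /=; case: insubP => [i _ /= <-|]; last first.
    rewrite -leqNgt => le_Nj; rewrite mderiv0 gtn_eqF //.
    exact: leq_trans (ltn_ord k) le_Nj.
  rewrite mderivX mnm1E (inj_eq (@rshift_inj _ _)) val_eqE.
  have [->|_] := eqVneq; last by rewrite scale0r.
  rewrite scale1r (_ : mnm_sub _ _ = mnm0) ?mpolyX0 //.
  by apply/mnmP => v; rewrite mnmBE subnn mnmE.
(* Newton's identity summed over a longer range; the additional terms have a negative index. *)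
have chomz_sum (m M : nat) : (m <= M)%N ->
    \sum_(j < M) qvar j.+1 * chomz qvar (m%:Z - j.+1%:Z) = m%:R * chomz qvar m.
  move=> le_mM; rewrite -(subnKC le_mM) big_split_ord /= [X in _ + X]big1; last first.
    move=> j _; rewrite (_ : _ - _ = Negz j) ?mulr0 // NegzE; lia.
  rewrite addr0; case: m le_mM => [|m] _; first by rewrite big_ord0 mul0r.
  rewrite (chomS natr_mpoly_unit); apply: eq_bigr => j _; congr (_ * _).
  by have := ltn_ord j; rewrite ltnS => le_jm; rewrite subzSS subzn.
elim/ltn_ind: n => -[_|n IH].
  by rewrite /chomz chom0 -mpolyC1 /dq mderivC scaler0.
apply: (mulrI (natr_mpoly_unit n)).
rewrite -scalerAr -mderiv_natM /= (chomS natr_mpoly_unit).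
rewrite [mderiv _ _]raddf_sum scaler_sumr /=.
have term (j : 'I_n.+1) :
    k.+1%:R *: mderiv (rshift N k) (qvar j.+1 * chom qvar (n - j)) =
    (if j == k :> nat then k.+1%:R * chom qvar (n - k) else 0)
    + qvar j.+1 * chomz qvar (n%:Z - k%:Z - j.+1%:Z).
  rewrite mderivM -!/(dq k _) dq_var scalerDr [X in _ + X]scalerAr (IH (n - j)%N) ?ltnS ?leq_subr //.
  congr (_ + _ * chomz _ _); last by have := ltn_ord j; lia.
  by case: eqP => [->|_]; rewrite ?mul0r ?scaler0 // mul1r -mpolyC_nat mul_mpolyC.
under eq_bigr do rewrite term.
rewrite big_split /= -big_mkcond /= (_ : n.+1%:Z - k.+1%:Z = n%:Z - k%:Z); last by lia.
have [le_kn|lt_nk] := leqP k n.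
  rewrite (big_pred1 (Ordinal (le_kn : (k < n.+1)%N))) => [|j]; last by [].
  rewrite subzn // chomz_sum; last by lia.
  by rewrite -mulrDl -natrD; congr (_%:R * _); lia.
rewrite (_ : n%:Z - k%:Z = Negz (k - n.+1)); last by rewrite NegzE; lia.
rewrite mulr0 big_pred0 => [|j]; last first.
  by apply/negbTE; have := ltn_ord j; lia.
rewrite add0r big1 // => j _.
by rewrite (_ : _ - _ = Negz (k - n.+1 + j.+1)) ?mulr0 // !NegzE; lia.
Qed.

End DeltaOperator.

(** Ring morphisms preserve Newton's identities, and these determine h. *)
Lemma rmorph_chomz (A C : comUnitRingType) (f : {rmorphism A -> C})
    (x : nat -> A) (y : nat -> C) :
  (forall n, (n.+1%:R : A) \is a GRing.unit) ->
  (forall n, (n.+1%:R : C) \is a GRing.unit) ->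
  (forall j, f (x j.+1) = y j.+1) -> forall n, f (chomz x n) = chomz y n.
Proof.
move=> uA uC fx [n|n]; last exact: rmorph0.
rewrite /= -(chom_uniq uC (h := f \o chom x)) //=; first by rewrite chom0 rmorph1.
move=> {}n; rewrite -(rmorph_nat f) -rmorphM (chomS uA) rmorph_sum.
by apply: eq_bigr => k _; rewrite rmorphM fx.
Qed.

(** * Delta as coefficient extraction *)

Section Umbral.
Variables (K : numFieldType) (N l : nat).
Local Notation QX := (mpoly (N + N) rat).
Implicit Types (F G : QX) (k : 'I_N).

(** The map [eval_at] over any numeric field; over R[i] the two are convertible. *)
Definition evalseq (p q : nat -> K) : QX -> K :=
  mmap ratr (fun v : 'I_(N + N) =>
    match fintype.split v with inl k => p k.+1 | inr k => q k.+1 end).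

HB.instance Definition _ p q := GRing.RMorphism.on (evalseq p q).

Lemma evalseq_xp p q k : evalseq p q (xp k) = p k.+1.
Proof. by rewrite /evalseq mmapX mmap1U (unsplitK (inl k)). Qed.

Lemma evalseq_qvar p q j : (forall i, (N < i)%N -> q i = 0) ->
  evalseq p q (qvar N j.+1) = q j.+1.
Proof.
move=> q0; rewrite /qvar /=; case: insubP => [k _ <-|].
  by rewrite /evalseq mmapX mmap1U (unsplitK (inr k)).
by rewrite -leqNgt => le_Nj; rewrite rmorph0 q0.
Qed.

Lemma evalseq_pvar p q j : (forall i, (N < i)%N -> p i = 0) ->
  evalseq p q (pvar N j.+1) = p j.+1.
Proof.
move=> p0; rewrite /pvar /=; case: insubP => [k _ <-|]; first by rewrite evalseq_xp.
by rewrite -leqNgt => le_Nj; rewrite rmorph0 p0.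
Qed.

Lemma evalseqZ p q a F : evalseq p q (a *: F) = ratr a * evalseq p q F.
Proof. exact: mmapZ. Qed.

(** The Leibniz rule: each summand lowers one index by k + 1. Without repetitions in [s], the shift
    meets only its own factor. *)
Lemma dq_prod (n : 'I_l -> int) k (s : seq 'I_l) : uniq s ->
  k.+1%:R *: dq k (\prod_(r <- s) chomz (qvar N) (n r)) =
  \sum_(i <- s) \prod_(r <- s) chomz (qvar N) (n r - ((r == i) * k.+1)%N%:Z).
Proof.
elim: s => [|a s IH] /=; first by rewrite !big_nil /dq -mpolyC1 mderivC scaler0.
move=> /andP[nas us]; rewrite !big_cons /dq mderivM -!/(dq k _) scalerDr.
rewrite scalerAl dq_qvar eqxx mul1n; congr (_ * _ + _).
  apply: eq_big_seq => r rs; rewrite (_ : r == a = false) ?mul0n ?subr0 //.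
  by apply: contraNF nas => /eqP <-.
rewrite scalerAr IH // mulr_sumr; apply: eq_big_seq => i si.
rewrite big_cons (_ : a == i = false) ?mul0n ?subr0 //.
by apply: contraNF nas => /eqP ->.
Qed.

Variables (p q : nat -> K) (B : nat).
Hypothesis q0 : forall i, (N < i)%N -> q i = 0.

Definition shift_eval : QX -> mpoly l K :=
  mmap (@mpolyC l K \o ratr) (fun v : 'I_(N + N) =>
    match fintype.split v with
    | inl k => mpolyC l (p k.+1) + \sum_r mpolyX K (mnm1 r) ^+ k.+1
    | inr k => mpolyC l (q k.+1)
    end).

HB.instance Definition _ := GRing.RMorphism.on shift_eval.

(** The generating series of the h_n(q), truncated. Only exponents below B are extracted, and
    multiplication by p_k merely lowers them. *)
Let h := \poly_(c < B) chom q c.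
Let H : mpoly l K := \prod_r in_var r h.

(* Delta (F(p) prod_r h_{n_r}(q)) is the coefficient of t^n in
   F(p + power sums of t) prod_r H(q; t_r): the two sides change in the same way
   when F is multiplied by p_k. *)
Definition umbral F : Prop := (forall k, dq k F = 0) /\
  forall n : 'I_l -> int, (forall r, n r < B%:Z) ->
  evalseq p q (Delta (F * \prod_r chomz (qvar N) (n r))) =
  zcoeff n (shift_eval F * H).

Lemma umbral1 : umbral 1.
Proof.
split=> [k|n ltnB]; first by rewrite /dq -mpolyC1 mderivC.
rewrite mul1r Delta_dp0 => [|k]; last first.
  apply: (big_ind (fun G => dp k G = 0)) => [|F G F0 G0|r _].
  - by rewrite /dp -mpolyC1 mderivC.
  - by rewrite /dp mderivM -!/(dp k _) F0 G0 mul0r mulr0 addr0.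
  - exact: dp_qvar.
rewrite rmorph1 mul1r zcoeff_prod_in_var rmorph_prod; apply: eq_bigr => r _.
rewrite (rmorph_chomz (@natr_mpoly_unit N) (@natr_unit K) (y := q)) => [|j]; last first.
  exact: evalseq_qvar.
by have := ltnB r; case: (n r) => // m lt_mB; rewrite coef_poly ifT.
Qed.

Lemma umbralD F G : umbral F -> umbral G -> umbral (F + G).
Proof.
move=> [F0 UF] [G0 UG]; split=> [k|n ltnB].
  by rewrite /dq mderivD -!/(dq k _) F0 G0 addr0.
by rewrite mulrDl !raddfD /= UF // UG // mulrDl raddfD.
Qed.

Lemma umbralZ a F : umbral F -> umbral (a *: F).
Proof.
move=> [F0 UF]; split=> [k|n ltnB].
  by rewrite /dq mderivZ -/(dq k _) F0 scaler0.
rewrite -scalerAl linearZ /= evalseqZ UF //.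
have -> : shift_eval (a *: F) = ratr a *: shift_eval F.
  by rewrite /shift_eval mmapZ /= mul_mpolyC.
by rewrite -scalerAl zcoeffZ.
Qed.

Lemma umbral0 : umbral 0.
Proof. by rewrite -(scale0r 1); apply: umbralZ umbral1. Qed.

Lemma umbral_sum (I : Type) (r : seq I) (P : pred I) (F : I -> QX) :
  (forall i, P i -> umbral (F i)) -> umbral (\sum_(i <- r | P i) F i).
Proof. by move=> UF; apply: big_ind => //; [exact: umbral0 | exact: umbralD]. Qed.

Lemma umbral_xpM k F : umbral F -> umbral (xp k * F).
Proof.
move=> [F0 UF]; split=> [k'|n ltnB].
  by rewrite /dq mderivM mderiv_xp eq_rlshift -/(dq _ _) F0 mul0r mulr0 addr0.
rewrite -mulrA Delta_xpM rmorphD rmorphM /= evalseq_xp UF //.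
set G := \prod_r _.
have -> : k.+1%:R *: Delta (dq k (F * G)) = \sum_i
    Delta (F * \prod_r chomz (qvar N) (n r - ((r == i) * k.+1)%N%:Z)).
  rewrite -linearZ -raddf_sum -mulr_sumr -dq_prod ?index_enum_uniq //=.
  by rewrite {1}/dq mderivM -!/(dq k _) F0 mul0r add0r scalerAr.
rewrite raddf_sum /=.
have -> : shift_eval (xp k * F) =
    (mpolyC l (p k.+1) + \sum_r mpolyX K (mnm1 r) ^+ k.+1) * shift_eval F.
  by rewrite rmorphM /= {1}/shift_eval mmapX mmap1U (unsplitK (inl k)).
rewrite -mulrA mulrDl raddfD /= mul_mpolyC zcoeffZ; congr (_ + _).
rewrite mulr_suml raddf_sum; apply: eq_bigr => i _ /=.
rewrite mpolyXn zcoeff_mulX UF => [|r]; last by have := ltnB r; lia.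
apply: eq_zcoeff => r; by rewrite mulmnE mnm1E eq_sym.
Qed.

(** By Newton's identity, multiplication by h_n is composed of multiplications by variables, to
    which [umbral_xpM] applies. *)
Lemma umbral_chomM n F : umbral F -> umbral (chomz (pvar N) n * F).
Proof.
move=> UF; case: n => n; last by rewrite mul0r; exact: umbral0.
elim/ltn_ind: n => -[_|n IH]; first by rewrite /= chom0 mul1r.
have -> : chomz (pvar N) n.+1 * F = n.+1%:R^-1 *:
    \sum_(k < n.+1) pvar N k.+1 * (chomz (pvar N) (n - k)%N * F).
  under eq_bigr do rewrite mulrA.
  rewrite -mulr_suml /= -(chomS (@natr_mpoly_unit N)) -mulrA -mpolyC_nat mul_mpolyC.
  by rewrite scalerA mulVf ?scale1r // pnatr_eq0.
apply/umbralZ/umbral_sum => k _; rewrite /pvar; case: insub => [v|].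
  by apply/umbral_xpM/IH; rewrite ltnS leq_subr.
by rewrite mul0r; exact: umbral0.
Qed.

Lemma umbral_jacobi_trudi lam m : umbral (\det (jacobi_trudi lam m (pvar N))).
Proof.
apply: umbral_sum => s _; rewrite mulr_sign.
have U : umbral (\prod_i jacobi_trudi lam m (pvar N) i (s i)).
  rewrite -[X in umbral X]mulr1.
  elim: (index_enum _) => [|i r IH]; first by rewrite big_nil mul1r; exact: umbral1.
  by rewrite big_cons -mulrA mxE; apply: umbral_chomM.
by case: ifP => // _; rewrite -scaleN1r; apply: umbralZ.
Qed.

End Umbral.

(** * Delta of a product of two Jacobi-Trudi determinants *)

Section DeltaJacobiTrudi.
Variables (K : numFieldType) (N : nat).
Local Notation QX := (mpoly (N + N) rat).
Implicit Types (F G : QX) (p q : nat -> K).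

(** A point of the affine space is a pair of sequences extended by zero, so these detect a rational
    polynomial. On them [pvar] and [qvar] take the values of the sequences. *)
Lemma evalseq_eq0 F :
  (forall p q, (forall i, (N < i)%N -> p i = 0) -> (forall i, (N < i)%N -> q i = 0) ->
    evalseq p q F = 0) -> F = 0.
Proof.
move=> F0.
suff F0K : map_mpoly (ratr : rat -> K) F = 0.
  apply/mpolyP => m; apply: (fmorph_inj (ratr : {rmorphism rat -> K})).
  by rewrite -mcoeff_map_mpoly F0K !mcoeff0 rmorph0.
apply: mpoly_grid_eq0 => v.
pose w (f : 'I_N -> 'I_(N + N)) (i : nat) : K :=
  if insub i.-1 is Some k then v (f k) else 0.
have w0 f i : (N < i)%N -> w f i = 0.
  by case: i => // i; rewrite ltnS /w /= => le_Ni; rewrite insubF // ltnNge le_Ni.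
rewrite -[RHS](F0 (w (lshift N)) (w (@rshift N N)) (w0 _) (w0 _)) /evalseq.
rewrite (map_mpolyE _ (leqnn _)) (mmapE _ (leqnn _)) raddf_sum; apply: eq_bigr => m _ /=.
rewrite mevalZ mevalX; congr (_ * _); apply: eq_bigr => i _; congr (_ ^+ _).
have valE (k : 'I_N) : insub (k.+1).-1 = Some k by rewrite /= (valK k).
by rewrite -{1}(splitK i) /w; case: (fintype.split i) => k /=; rewrite valK.
Qed.

Lemma evalseq_det_jacobi_trudi (x : nat -> QX) (y : nat -> K) lam l p q :
  (forall j, evalseq p q (x j.+1) = y j.+1) ->
  evalseq p q (\det (jacobi_trudi lam l x)) = \det (jacobi_trudi lam l y).
Proof.
move=> xy; rewrite -det_map_mx; congr (\det _); apply/matrixP => i j; rewrite !mxE.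
by apply: rmorph_chomz => //; [exact: natr_mpoly_unit | exact: natr_unit].
Qed.

Variables (F G : QX) (lam mu : seq nat) (l : nat).
Hypothesis evalF : forall p q, evalseq p q F = \det (jacobi_trudi lam l p).
Hypothesis evalG : forall p q, evalseq p q G = \det (jacobi_trudi mu l q).

(** Delta needs F as a polynomial, not as a function; comparing at sequences that vanish beyond N
    hides the truncation in [pvar]. *)
Lemma evalseq_inj_pvar : F = \det (jacobi_trudi lam l (pvar N)).
Proof.
apply/eqP; rewrite -subr_eq0; apply/eqP/evalseq_eq0 => p q p0 q0.
rewrite rmorphB /= evalF (evalseq_det_jacobi_trudi _ _ (y := p)) ?subrr // => j.
exact: evalseq_pvar.
Qed.

Lemma evalseq_inj_qvar : G = \det (jacobi_trudi mu l (qvar N)).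
Proof.
apply/eqP; rewrite -subr_eq0; apply/eqP/evalseq_eq0 => p q p0 q0.
rewrite rmorphB /= evalG (evalseq_det_jacobi_trudi _ _ (y := q)) ?subrr // => j.
exact: evalseq_qvar.
Qed.

Variables (p q : nat -> K).
Hypothesis q0 : forall i, (N < i)%N -> q i = 0.
Let L := (l + (sumn lam + sumn mu))%N.
Let A (i : 'I_l) := \poly_(e < L) chomz p (l%:Z - 1 - e%:Z - i%:Z + (nth 0%N lam i)%:Z).

(** Both sides are polynomials in t and are compared at all points. There [shift_eval] becomes the
    value of F at p + power sums of t, a sequence with infinitely many nonzero terms in general, so
    [evalF] is required at all sequences. *)
Lemma vandermonde_shift_eval :
  \det (\matrix_(c < l, r < l) (mpolyX K (mnm1 r) ^+ (l - c.+1) : mpoly l K)) *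
    shift_eval l p q F =
  \det (\matrix_(i < l, r < l) in_var r (A i)).
Proof.
apply/eqP; rewrite -subr_eq0; apply/eqP/mpoly_grid_eq0 => t.
rewrite mevalB mevalM -!det_map_mx /=.
have -> : meval t (shift_eval l p q F) =
    evalseq (fun k => p k + \sum_(r < l) t r ^+ k) q F.
  rewrite [F]mpolyE [shift_eval _ _ _ _]raddf_sum [meval _ _]raddf_sum.
  rewrite [evalseq _ _ _]raddf_sum; apply: eq_bigr => m _ /=.
  rewrite evalseqZ /shift_eval mmapZ mevalM /= mevalC; congr (_ * _).
  rewrite /evalseq !mmapX /mmap1 rmorph_prod; apply: eq_bigr => v _ /=.
  rewrite rmorphXn /=; congr (_ ^+ _); case: (fintype.split v) => k; last by rewrite mevalC.
  rewrite mevalD mevalC raddf_sum /=; congr (_ + _); apply: eq_bigr => r _.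
  by rewrite rmorphXn /= mevalXU.
rewrite evalF.
have -> : map_mx (meval t)
    (\matrix_(c < l, r < l) (mpolyX K (mnm1 r) ^+ (l - c.+1) : mpoly l K)) =
    \matrix_(c < l, r < l) t r ^+ (l - c.+1).
  by apply/matrixP => c r; rewrite !mxE rmorphXn /= mevalXU.
rewrite (vandermonde_jacobi_trudi (@natr_unit K) lam (sumn mu) (p := p)) //.
apply/eqP; rewrite subr_eq0; apply/eqP; congr (\det _).
apply/matrixP => i r; rewrite !mxE (in_var_wide r (size_poly _ _)) raddf_sum.
apply: eq_bigr => e _ /=; rewrite mevalM mevalC rmorphXn /= mevalXU.
by rewrite coef_poly ltn_ord.
Qed.

Lemma evalseq_Delta_jt : evalseq p q (Delta (F * G)) = \det (jt lam mu l L p q).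
Proof.
pose B := (l + sumn mu)%N.
have le_mu := nth_le_sumn mu.
(* The term of the permutation s in the expansion of G asks for the exponents s r - r + mu_r. The
   Vandermonde monomial of the same s multiplies by t_r^(l - 1 - s r), moving them to [n0 r], which
   is independent of s. *)
pose n0 (r : 'I_l) : int := l%:Z - 1 - r%:Z + (nth 0%N mu r)%:Z.
pose h := \poly_(c < B) chom q c.
have [_ umbF] : umbral l p q B F.
  by rewrite evalseq_inj_pvar; exact: umbral_jacobi_trudi.
transitivity (zcoeff n0 (\det (\matrix_(i < l, r < l) in_var r (A i)) *
    \prod_r in_var r h)).
  rewrite -vandermonde_shift_eval -mulrA {1}evalseq_inj_qvar -[in RHS]det_tr /determinant.
  rewrite mulr_sumr [Delta _]raddf_sum [evalseq _ _ _]raddf_sum.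
  rewrite [(\sum_s _) * _]mulr_suml [zcoeff _ _]raddf_sum; apply: eq_bigr => s _ /=.
  set V := \prod_r _; set X := \prod_r _.
  have core : evalseq p q (Delta (F * V)) =
      zcoeff n0 (X * (shift_eval l p q F * \prod_r in_var r h)).
    pose m : multinom l := Multinom (mktuple (fun r => (l - (s r).+1)%N)).
    have -> : X = mpolyX K m.
      by rewrite mpolyXE_id; apply: eq_bigr => r _; rewrite !mxE mnmE.
    have -> : V = \prod_r chomz (qvar N) ((s r)%:Z - r%:Z + (nth 0%N mu r)%:Z).
      by apply: eq_bigr => r _; rewrite mxE.
    rewrite umbF => [|r]; last first.
      by have := le_mu r; have := ltn_ord (s r); rewrite /B; lia.
    rewrite zcoeff_mulX; apply: eq_zcoeff => r; rewrite mnmE /n0.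
    by have := ltn_ord (s r); lia.
  rewrite !mulr_sign; case: (odd_perm _) => //.
  by rewrite mulrN mulNr [Delta _]raddfN [evalseq _ _ _]raddfN [zcoeff _ _]raddfN /= core.
(* The column r contains only t_r, so the coefficient factors over r; each factor is a convolution
   of [A] with the series of the h_n(q), and this is an entry of [jt]. *)
rewrite -[in LHS]det_tr -[in RHS]det_tr /determinant mulr_suml [zcoeff _ _]raddf_sum.
apply: eq_bigr => s _ /=.
have core : zcoeff n0 (\prod_r in_var r (A (s r)) * \prod_r in_var r h) =
    \prod_r jt lam mu l L p q (s r) r.
  rewrite -big_split /=; under eq_bigr do rewrite -in_varM.
  rewrite zcoeff_prod_in_var; apply: eq_bigr => r _; rewrite mxE.
  have lt_rl := ltn_ord r; have le_mur := le_mu r.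
  have n0E : n0 r = (l - r.+1 + nth 0%N mu r)%N by rewrite /n0; lia.
  rewrite n0E /= coefM.
  have le_nL : ((l - r.+1 + nth 0%N mu r).+1 <= L)%N by rewrite /L; lia.
  rewrite -(subnKC le_nL) big_split_ord /= [X in _ = _ + X]big1 ?addr0 => [|e _]; last first.
    rewrite [X in _ * chomz _ X](_ : _ = Negz e) ?mulr0 //.
    by rewrite NegzE; lia.
  apply: eq_bigr => e _; have lt_e := ltn_ord e.
  rewrite !coef_poly ifT ?ifT; last 2 first.
  - by rewrite /B; lia.
  - exact: leq_trans lt_e le_nL.
  congr (_ * _); transitivity (chomz q (l - r.+1 + nth 0 mu r - e)%N%:Z) => //.
  by congr (chomz q _); lia.
under [X in _ * X * _]eq_bigr do rewrite !mxE.
under [X in _ = _ * X]eq_bigr do rewrite mxE.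
rewrite -core !mulr_sign; case: (odd_perm _) => //.
by rewrite mulNr [zcoeff _ _]raddfN.
Qed.

End DeltaJacobiTrudi.

Import numFieldNormedType.Exports.

(** * Fourier coefficients of rational symbols *)

Section LogSeries.
Variable R : realType.
Implicit Types (c : nat -> R) (r K theta : R).

(** The linear bound covers the second formal derivative of the logarithmic series. Convergence
    follows from a closed form for the partial sums of (i + 1) K^i. *)
Lemma cvg_pseries_linear c K : (forall i, `|c i| <= i.+1%:R) -> 0 <= K -> K < 1 ->
  cvgn (pseries c K).
Proof.
move=> cle K0 K1; apply: normed_cvg.
apply: (@series_le_cvg _ _ (fun i => i.+1%:R * K ^+ i)) => [i|i|i|].
- exact: normr_ge0.
- by rewrite mulr_ge0 ?exprn_ge0.
- by rewrite /= normrM (ger0_norm (exprn_ge0 _ K0)) ler_wpM2r ?exprn_ge0.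
have sumE n : (1 - K) ^+ 2 * series (fun i => i.+1%:R * K ^+ i) n =
    1 - n.+1%:R * K ^+ n + n%:R * K ^+ n.+1.
  elim: n => [|n IH]; first by rewrite seriesEnat /= big_geq // expr0; ring.
  rewrite seriesEnat /= big_nat_recr //= mulrDr.
  move: IH; rewrite seriesEnat /= => ->; rewrite !exprS -!natr1; ring.
have K1' : 0 < (1 - K) ^+ 2 by rewrite exprn_gt0 // subr_gt0.
apply: nondecreasing_is_cvgn.
  apply/nondecreasing_seqP => n; rewrite !seriesEnat /= big_nat_recr //= lerDl.
  by rewrite mulr_ge0 ?exprn_ge0.
exists ((1 - K) ^- 2) => _ [n _ <-].
rewrite -(ler_pM2l K1') sumE mulfV ?gt_eqF //.
rewrite exprS -natr1 mulrDl mul1r.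
have : 0 <= K ^+ n by rewrite exprn_ge0.
have : n%:R * (K * K ^+ n) <= n%:R * K ^+ n.
  by rewrite ler_wpM2l // ler_piMl ?exprn_ge0 // ltW.
lra.
Qed.

(** At i = 0 the value is 0, because the inverse of 0 is 0. *)
Definition cos_coef theta (i : nat) : R := cos (i%:R * theta) / i%:R.
Definition sin_coef theta (i : nat) : R := sin (i%:R * theta) / i%:R.

(* Real and imaginary part of -log (1 - r e^(i theta)). *)
Definition log_re theta r : R := limn (pseries (cos_coef theta) r).
Definition log_im theta r : R := limn (pseries (sin_coef theta) r).

Lemma norm_cos_coef theta i : `|cos_coef theta i| <= 1.
Proof.
rewrite /cos_coef normrM normfV normr_nat; case: i => [|i].
  by rewrite invr0 mulr0 ler01.
rewrite ler_pdivrMr ?ltr0n // mul1r (le_trans (cos_max _)) // ler1n //.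
Qed.

Lemma norm_sin_coef theta i : `|sin_coef theta i| <= 1.
Proof.
rewrite /sin_coef normrM normfV normr_nat; case: i => [|i].
  by rewrite invr0 mulr0 ler01.
by rewrite ler_pdivrMr ?ltr0n // mul1r (le_trans (sin_max _)) // ler1n.
Qed.

Lemma diffs_cos_coef theta i : pseries_diffs (cos_coef theta) i = cos (i.+1%:R * theta).
Proof. by rewrite /pseries_diffs /cos_coef mulrC divfK ?pnatr_eq0. Qed.

Lemma diffs_sin_coef theta i : pseries_diffs (sin_coef theta) i = sin (i.+1%:R * theta).
Proof. by rewrite /pseries_diffs /sin_coef mulrC divfK ?pnatr_eq0. Qed.

Lemma is_derive_limn_pseries c r :
  (forall i, `|c i| <= 1) -> (forall i, `|pseries_diffs c i| <= 1) ->
  0 <= r -> r < 1 ->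
  is_derive r 1 (fun x => limn (pseries c x)) (limn (pseries (pseries_diffs c) r)).
Proof.
(* Any K strictly between r and 1 would do; the midpoint is taken. *)
move=> c1 dc1 r0 r1; set K := (1 + r) / 2.
have K0 : 0 <= K by rewrite /K; lra.
have K1 : K < 1 by rewrite /K; lra.
have ge1 (i : nat) : 1 <= i.+1%:R :> R by rewrite ler1n.
apply: (@pseries_snd_diffs _ _ K).
- by apply: cvg_pseries_linear => // i; apply: le_trans (c1 i) (ge1 i).
- by apply: cvg_pseries_linear => // i; apply: le_trans (dc1 i) (ge1 i).
- apply: cvg_pseries_linear => // i; rewrite {1}/pseries_diffs normrM normr_nat.
  by rewrite ler_piMr // dc1.
- by rewrite !ger0_norm //; rewrite /K; lra.
Qed.

(** Real part, and below imaginary part, of e^(i theta) / (1 - r e^(i theta)). *)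
Definition geo_re theta r : R := limn (pseries (fun i => cos (i.+1%:R * theta)) r).
Definition geo_im theta r : R := limn (pseries (fun i => sin (i.+1%:R * theta)) r).

Lemma is_derive_log_re theta r : 0 <= r -> r < 1 ->
  is_derive r 1 (log_re theta) (geo_re theta r).
Proof.
move=> r0 r1; rewrite /geo_re -(funext (diffs_cos_coef theta)).
apply: is_derive_limn_pseries => // i; first exact: norm_cos_coef.
by rewrite diffs_cos_coef cos_max.
Qed.

Lemma is_derive_log_im theta r : 0 <= r -> r < 1 ->
  is_derive r 1 (log_im theta) (geo_im theta r).
Proof.
move=> r0 r1; rewrite /geo_im -(funext (diffs_sin_coef theta)).
apply: is_derive_limn_pseries => // i; first exact: norm_sin_coef.
by rewrite diffs_sin_coef sin_max.
Qed.

(** The equation G = e^(i theta) (1 + r G) in real and imaginary parts, obtained as the limit of its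
    version for partial sums. *)
Lemma geo_rec theta r : 0 <= r -> r < 1 ->
  geo_re theta r = cos theta + r * (cos theta * geo_re theta r - sin theta * geo_im theta r)
  /\ geo_im theta r = sin theta + r * (sin theta * geo_re theta r + cos theta * geo_im theta r).
Proof.
move=> r0 r1.
set U := pseries (fun i => cos (i.+1%:R * theta)) r.
set V := pseries (fun i => sin (i.+1%:R * theta)) r.
have ge1 (i : nat) : 1 <= i.+1%:R :> R by rewrite ler1n.
have cU : U @ \oo --> geo_re theta r.
  by apply: cvg_pseries_linear => // i; apply: le_trans (cos_max _) (ge1 i).
have cV : V @ \oo --> geo_im theta r.
  by apply: cvg_pseries_linear => // i; apply: le_trans (sin_max _) (ge1 i).
have recU n : U n.+1 = cos theta + r * (cos theta * U n - sin theta * V n).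
  rewrite /U /V /pseries !seriesEnat /= big_nat_recl // mul1r expr0 mulr1.
  congr (_ + _); rewrite !mulr_sumr -sumrB mulr_sumr; apply: eq_bigr => i _.
  rewrite -natr1 mulrDl mul1r cosD exprS; ring.
have recV n : V n.+1 = sin theta + r * (sin theta * U n + cos theta * V n).
  rewrite /U /V /pseries !seriesEnat /= big_nat_recl // mul1r expr0 mulr1.
  congr (_ + _); rewrite !mulr_sumr -big_split mulr_sumr; apply: eq_bigr => i _ /=.
  rewrite -natr1 mulrDl mul1r sinD exprS; ring.
have cU1 : [sequence U n.+1]_n @ \oo --> geo_re theta r by rewrite cvg_shiftS.
have cV1 : [sequence V n.+1]_n @ \oo --> geo_im theta r by rewrite cvg_shiftS.
rewrite (funext recU) in cU1; rewrite (funext recV) in cV1.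
split; [apply: (cvg_unique (@Rhausdorff R) cU1)|apply: (cvg_unique (@Rhausdorff R) cV1)].
- by apply: cvgD; [exact: cvg_cst|apply: cvgM; [exact: cvg_cst|
    apply: cvgB; apply: cvgM => //; exact: cvg_cst]].
- by apply: cvgD; [exact: cvg_cst|apply: cvgM; [exact: cvg_cst|
    apply: cvgD; apply: cvgM => //; exact: cvg_cst]].
Qed.

Lemma log_re0 theta : log_re theta 0 = 0.
Proof.
rewrite /log_re; apply: (@cvg_lim _ (@Rhausdorff R)).
rewrite (_ : pseries _ _ = fun=> 0); first exact: cvg_cst.
apply/funext => n; rewrite /pseries seriesEnat /= big1 // => -[|i] _.
  by rewrite /cos_coef invr0 mulr0 mul0r.
by rewrite expr0n mulr0.
Qed.

Lemma log_im0 theta : log_im theta 0 = 0.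
Proof.
rewrite /log_im; apply: (@cvg_lim _ (@Rhausdorff R)).
rewrite (_ : pseries _ _ = fun=> 0); first exact: cvg_cst.
apply/funext => n; rewrite /pseries seriesEnat /= big1 // => -[|i] _.
  by rewrite /sin_coef invr0 mulr0 mul0r.
by rewrite expr0n mulr0.
Qed.

(* The derivative in r of (1 - r e^(i theta)) exp (- log (1 - r e^(i theta)))
   vanishes, by the geometric recursion [geo_rec]. *)
Lemma exp_log_series theta r : 0 <= r -> r < 1 ->
  let u := expR (log_re theta r) * cos (log_im theta r) in
  let v := expR (log_re theta r) * sin (log_im theta r) in
  (1 - r * cos theta) * u + r * sin theta * v = 1 /\
  (1 - r * cos theta) * v - r * sin theta * u = 0.
Proof.
move=> r0 r1 /=.
pose u x := expR (log_re theta x) * cos (log_im theta x).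
pose v x := expR (log_re theta x) * sin (log_im theta x).
pose X (x : R) : R := (1 + x * (- cos theta)) * u x + (0 + x * sin theta) * v x.
pose Y (x : R) : R := (1 + x * (- cos theta)) * v x + (0 + x * (- sin theta)) * u x.
have dX (x : R) : 0 <= x -> x < 1 -> is_derive x 1 X 0 /\ is_derive x 1 Y 0.
  move=> x0 x1.
  have dA := is_derive_log_re theta x0 x1.
  have dB := is_derive_log_im theta x0 x1.
  have [recU recV] := geo_rec theta x0 x1.
  have dE : is_derive x 1 (expR \o log_re theta)
      (expR (log_re theta x) * geo_re theta x).
    exact: is_derive1_comp.
  have dC : is_derive x 1 (cos \o log_im theta) (- sin (log_im theta x) * geo_im theta x).
    exact: is_derive1_comp.
  have dS : is_derive x 1 (sin \o log_im theta) (cos (log_im theta x) * geo_im theta x).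
    exact: is_derive1_comp.
  have du : is_derive x 1 u (geo_re theta x * u x - geo_im theta x * v x).
    apply: is_derive_eq (is_deriveM dE dC) _.
    by rewrite /u /v /GRing.scale /=; ring.
  have dv : is_derive x 1 v (geo_re theta x * v x + geo_im theta x * u x).
    apply: is_derive_eq (is_deriveM dE dS) _.
    by rewrite /u /v /GRing.scale /=; ring.
  have dl (a b : R) : is_derive x 1 (fun y : R => a + y * b) b.
    rewrite -[X in is_derive _ _ _ X]add0r -[X in _ + X](scale1r b).
    apply: is_deriveD; rewrite -[X in is_derive _ _ _ X]addr0.
    by rewrite (_ : 1 *: b + 0 = x *: 0 + b *: 1); [exact: is_deriveM | rewrite /GRing.scale /=; ring].
  split.
    apply: is_derive_eq (is_deriveD (is_deriveM (dl 1 (- cos theta)) du)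
      (is_deriveM (dl 0 (sin theta)) dv)) _.
    rewrite /GRing.scale /=.
    set a := geo_re theta x in recU recV *; set b := geo_im theta x in recU recV *.
    (* The derivative is a combination of the defects of the two equations in [geo_rec]. *)
    transitivity (u x * (a - (cos theta + x * (cos theta * a - sin theta * b)))
      - v x * (b - (sin theta + x * (sin theta * a + cos theta * b)))); first by ring.
    by rewrite -recU -recV; ring.
  apply: is_derive_eq (is_deriveD (is_deriveM (dl 1 (- cos theta)) dv)
    (is_deriveM (dl 0 (- sin theta)) du)) _.
  rewrite /GRing.scale /=.
  set a := geo_re theta x in recU recV *; set b := geo_im theta x in recU recV *.
  transitivity (v x * (a - (cos theta + x * (cos theta * a - sin theta * b)))
    + u x * (b - (sin theta + x * (sin theta * a + cos theta * b)))); first by ring.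
  by rewrite -recU -recV; ring.
have cst (f : R -> R) : (forall x : R, 0 <= x -> x < 1 -> is_derive x 1 f 0) -> f r = f 0.
  move=> df.
  have inr (x : R) : x \in `[0, r] -> 0 <= x /\ x < 1.
    by rewrite in_itv /= => /andP[x0 xr]; split => //; apply: le_lt_trans xr r1.
  have [||c _] := @MVT_segment _ f (fun=> 0) 0 r r0; last first.
  - by rewrite mul0r => /eqP; rewrite subr_eq0 => /eqP.
  - apply: derivable_within_continuous => x /inr[x0 x1].
    by have d := df x x0 x1; exact: ex_derive.
  - by move=> x /subset_itv_oo_cc /inr[x0 x1]; exact: df.
have X0 : X r = X 0 by apply: cst => x x0 x1; have [] := dX x x0 x1.
have Y0 : Y r = Y 0 by apply: cst => x x0 x1; have [] := dX x x0 x1.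
have u0 : u 0 = 1 by rewrite /u log_re0 log_im0 expR0 cos0 mul1r.
have v0 : v 0 = 0 by rewrite /v log_re0 log_im0 sin0 mulr0.
move: X0 Y0; rewrite /X /Y u0 v0 -/(u r) -/(v r) => X0 Y0.
split.
  by transitivity (X r); [rewrite /X -/(u r) -/(v r); ring | rewrite /X X0; ring].
by transitivity (Y r); [rewrite /Y -/(u r) -/(v r); ring | rewrite /Y Y0; ring].
Qed.

End LogSeries.

(** * The symbol attached to power sums, in closed form *)

Section ExplicitSymbol.
Variable R : realType.
Implicit Types (xs ys : seq R) (theta r : R).
Local Notation C := R[i].

Lemma cisD (a b : R) : cis (a + b) = cis a * cis b.
Proof. by rewrite /cis cosD sinD; simpc; rewrite addrC [X in _ +i* X]addrC. Qed.

Lemma cis0 : cis 0 = 1 :> C.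
Proof. by rewrite /cis cos0 sin0. Qed.

Lemma cisN (a : R) : cis (- a) = (cis a)^-1.
Proof.
have E : cis a * cis (- a) = 1 by rewrite -cisD subrr cis0.
have nz : cis a != 0 by apply: contra_eq_neq E => ->; rewrite mul0r eq_sym oner_eq0.
by apply: (mulfI nz); rewrite E mulfV.
Qed.

Lemma cisX (a : R) n : cis a ^+ n = cis (n%:R * a).
Proof.
elim: n => [|n IH]; first by rewrite mul0r cis0.
by rewrite exprS IH -cisD -natr1 mulrDl mul1r addrC.
Qed.

Lemma cexpD (z w : C) : cexp (z + w) = cexp z * cexp w.
Proof.
by rewrite /cexp !raddfD /= expRD cisD rmorphM /= mulrACA.
Qed.

Lemma cexp0 : cexp 0 = 1 :> C.
Proof. by rewrite /cexp /= expR0 cis0 mulr1. Qed.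

Lemma Re_sum (I : Type) (s : seq I) (F : I -> C) :
  complex.Re (\sum_(i <- s) F i) = \sum_(i <- s) complex.Re (F i).
Proof. by elim: s => [|i s IH]; rewrite ?big_nil // !big_cons raddfD /= IH. Qed.

Lemma Im_sum (I : Type) (s : seq I) (F : I -> C) :
  complex.Im (\sum_(i <- s) F i) = \sum_(i <- s) complex.Im (F i).
Proof. by elim: s => [|i s IH]; rewrite ?big_nil // !big_cons raddfD /= IH. Qed.

Lemma normc_le (z : C) : `|z| <= (`|complex.Re z| + `|complex.Im z|)%:C.
Proof.
rewrite normc_def lecR -ler_sqr ?nnegrE ?sqrtr_ge0 ?addr_ge0 //.
rewrite sqr_sqrtr ?addr_ge0 ?sqr_ge0 // sqrrD !real_normK ?num_real //.
by rewrite addrAC lerDl; apply/mulrn_wge0/mulr_ge0; exact: normr_ge0.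
Qed.

Lemma cvg_complex (u : nat -> C) (z : C) :
  (fun n => complex.Re (u n)) @ \oo --> complex.Re z ->
  (fun n => complex.Im (u n)) @ \oo --> complex.Im z ->
  (u : nat -> C^o) @ \oo --> (z : C^o).
Proof.
move=> /cvgrPdist_lt cRe /cvgrPdist_lt cIm; apply/cvgrPdist_lt => -[e e'].
rewrite ltcE /= => /andP[/eqP-> e0].
have e2 : 0 < e / 2 by rewrite divr_gt0.
near=> n.
rewrite (le_lt_trans (normc_le _)) // ltcR raddfB raddfB /= [e]splitr.
by rewrite ltrD //; near: n; [exact: cRe | exact: cIm].
Unshelve. all: by end_near. Qed.

Definition clog theta r : C := log_re theta r +i* log_im theta r.

Lemma cexp_clog theta r : 0 <= r -> r < 1 ->
  cexp (clog theta r) * (1 - r%:C * cis theta) = 1.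
Proof.
move=> r0 r1; have [E1 E2] := exp_log_series theta r0 r1.
rewrite /cexp /clog /cis /=; apply/eqP; rewrite eq_complex /=; apply/andP.
split; apply/eqP; [rewrite -[RHS]E1|rewrite -[RHS]E2]; ring.
Qed.

Lemma cvg_sum_in (I : eqType) (s : seq I) (F : I -> nat -> R) (l : I -> R) :
  (forall i, i \in s -> F i @ \oo --> l i) ->
  (fun n => \sum_(i <- s) F i n) @ \oo --> \sum_(i <- s) l i.
Proof.
elim: s => [|i s IH] Fl.
  by rewrite big_nil; under eq_fun do rewrite big_nil; exact: cvg_cst.
rewrite big_cons; under eq_fun do rewrite big_cons; apply: cvgD.
  by apply: Fl; rewrite mem_head.
by apply: IH => j js; apply: Fl; rewrite inE js orbT.
Qed.

Lemma pseries_shift (c : nat -> R) r n : c 0%N = 0 ->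
  \sum_(0 <= k < n) c k.+1 * r ^+ k.+1 = pseries c r n.+1.
Proof.
by move=> c0; rewrite /pseries seriesEnat /= big_nat_recl // c0 mul0r add0r.
Qed.

Lemma cvg_clog_series (c : nat -> R -> R) theta r : (forall i, `|c i theta| <= 1) ->
  c 0%N theta = 0 -> 0 <= r -> r < 1 ->
  (fun n => \sum_(0 <= k < n) c k.+1 theta * r ^+ k.+1) @ \oo -->
    limn (pseries (c ^~ theta) r).
Proof.
move=> c1 c0 r0 r1; under eq_fun do rewrite (@pseries_shift (c ^~ theta)) //.
have H : [sequence pseries (c ^~ theta) r n.+1]_n @ \oo --> limn (pseries (c ^~ theta) r).
  rewrite cvg_shiftS; apply: cvg_pseries_linear => // i.
  by rewrite (le_trans (c1 i)) // ler1n.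
exact: H.
Qed.

(** Exchanging the sums over k and over the points gives one logarithmic series per point; negative
    powers of t are positive powers of [cis (- theta)]. *)
Lemma log_symbolE (xs ys : seq R) theta :
  all (fun x => 0 < x < 1) xs -> all (fun x => 0 < x < 1) ys ->
  log_symbol (psum [seq x%:C | x <- xs]) (psum [seq y%:C | y <- ys]) (cis theta) =
  \sum_(x <- xs) clog theta x + \sum_(y <- ys) clog (- theta) y.
Proof.
move=> x01 y01; rewrite /log_symbol; apply: (@cvg_lim C^o); first exact: norm_hausdorff.
have term (a : R) (zs : seq R) k : psum [seq z%:C | z <- zs] k.+1 / k.+1%:R * cis a ^+ k.+1 =
    \sum_(z <- zs) (cos_coef a k.+1 * z ^+ k.+1 +i* (sin_coef a k.+1 * z ^+ k.+1)).
  rewrite /psum big_map -mulrA mulr_suml; apply: eq_bigr => z _.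
  rewrite cisX /cos_coef /sin_coef -rmorphXn -[k.+1%:R]/(k.+1%:R) -(rmorph_nat (real_complex R)).
  rewrite -fmorphV /cis; simpc => /=; congr (_ +i* _); ring.
have seriesE n : series (fun k : nat =>
    psum [seq x%:C | x <- xs] k.+1 / k.+1%:R * cis theta ^+ k.+1 +
    psum [seq y%:C | y <- ys] k.+1 / k.+1%:R * cis theta ^- k.+1) n =
  \sum_(x <- xs) ((\sum_(0 <= k < n) cos_coef theta k.+1 * x ^+ k.+1) +i*
     (\sum_(0 <= k < n) sin_coef theta k.+1 * x ^+ k.+1)) +
  \sum_(y <- ys) ((\sum_(0 <= k < n) cos_coef (- theta) k.+1 * y ^+ k.+1) +i*
     (\sum_(0 <= k < n) sin_coef (- theta) k.+1 * y ^+ k.+1)).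
  have sumC (f g : nat -> R) : (\sum_(0 <= k < n) f k) +i* (\sum_(0 <= k < n) g k) =
      \sum_(0 <= k < n) (f k +i* g k).
    by apply/eqP; rewrite eq_complex /= Re_sum Im_sum /= !eqxx.
  rewrite seriesEnat /=.
  under eq_bigr do rewrite -exprVn -cisN !term.
  rewrite big_split /= exchange_big [X in _ + X]exchange_big /=.
  by congr (_ + _); apply: eq_bigr => z _; rewrite sumC.
have c0 a : cos_coef a 0 = 0 :> R by rewrite /cos_coef invr0 mulr0.
have s0 a : sin_coef a 0 = 0 :> R by rewrite /sin_coef invr0 mulr0.
have pos (zs : seq R) z : all (fun x => 0 < x < 1) zs -> z \in zs -> 0 <= z /\ z < 1.
  by move=> /allP z01 /z01 /andP[/ltW].
rewrite (funext seriesE); apply: cvg_complex.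
  under eq_fun do rewrite raddfD /= !Re_sum /=.
  rewrite raddfD /= !Re_sum; apply: cvgD; apply: cvg_sum_in => z zs /=.
    have [z0 z1] := pos _ _ x01 zs.
    by apply: (@cvg_clog_series (fun i a => cos_coef a i)) => // i; exact: norm_cos_coef.
  have [z0 z1] := pos _ _ y01 zs.
  by apply: (@cvg_clog_series (fun i a => cos_coef a i)) => // i; exact: norm_cos_coef.
under eq_fun do rewrite raddfD /= !Im_sum /=.
rewrite raddfD /= !Im_sum; apply: cvgD; apply: cvg_sum_in => z zs /=.
  have [z0 z1] := pos _ _ x01 zs.
  by apply: (@cvg_clog_series (fun i a => sin_coef a i)) => // i; exact: norm_sin_coef.
have [z0 z1] := pos _ _ y01 zs.
by apply: (@cvg_clog_series (fun i a => sin_coef a i)) => // i; exact: norm_sin_coef.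
Qed.

Lemma symbolE (xs ys : seq R) theta :
  all (fun x => 0 < x < 1) xs -> all (fun x => 0 < x < 1) ys ->
  symbol (psum [seq x%:C | x <- xs]) (psum [seq y%:C | y <- ys]) (cis theta) =
  \prod_(x <- xs) (1 - x%:C * cis theta)^-1 * \prod_(y <- ys) (1 - y%:C * cis (- theta))^-1.
Proof.
move=> x01 y01; rewrite /symbol log_symbolE // cexpD.
have cexp_sum a zs : all (fun x => 0 < x < 1) zs ->
    cexp (\sum_(x <- zs) clog a x) = \prod_(x <- zs) (1 - x%:C * cis a)^-1.
  elim: zs => [|z zs IH] /=; first by rewrite !big_nil cexp0.
  move=> /andP[/andP[/ltW z0 z1] zs01]; rewrite !big_cons cexpD IH //; congr (_ * _).
  have E := cexp_clog a z0 z1.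
  have nz : 1 - z%:C * cis a != 0.
    by apply: contra_eq_neq E => ->; rewrite mulr0 eq_sym oner_eq0.
  by apply: (mulIf nz); rewrite E mulVf.
by rewrite !cexp_sum.
Qed.

End ExplicitSymbol.

(** * Fourier coefficients as integrals over a period *)

Section FourierCoefficients.
Variable R : realType.
Local Notation C := R[i].
Implicit Types (G : R -> C) (theta : R).

(** Componentwise, since [circle_integral] integrates real and imaginary part separately. *)
Definition re_im_continuous G :=
  continuous (fun x => complex.Re (G x)) /\ continuous (fun x => complex.Im (G x)).

Lemma re_im_continuous_cst (z : C) : re_im_continuous (fun=> z).
Proof. by split=> x; exact: cvg_cst. Qed.

Lemma re_im_continuous_cis (a : R) : re_im_continuous (fun x => cis (a * x)).
Proof.
split=> x /=.
  apply: (@continuous_comp _ _ _ (fun y : R => a * y) cos); last exact: continuous_cos.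
  by apply: cvgM; [exact: cvg_cst | exact: cvg_id].
apply: (@continuous_comp _ _ _ (fun y : R => a * y) sin); last exact: continuous_sin.
by apply: cvgM; [exact: cvg_cst | exact: cvg_id].
Qed.

Lemma ReM (z w : C) :
  complex.Re (z * w) = complex.Re z * complex.Re w - complex.Im z * complex.Im w.
Proof. by case: z w => [a b] [c d]. Qed.

Lemma ImM (z w : C) :
  complex.Im (z * w) = complex.Re z * complex.Im w + complex.Im z * complex.Re w.
Proof. by case: z w => [a b] [c d]. Qed.

Lemma re_im_continuousD G1 G2 : re_im_continuous G1 -> re_im_continuous G2 ->
  re_im_continuous (fun x => G1 x + G2 x).
Proof.
move=> [r1 i1] [r2 i2]; split=> x.
  under eq_fun do rewrite raddfD /=.
  by apply: cvgD; [exact: r1 | exact: r2].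
under eq_fun do rewrite raddfD /=.
by apply: cvgD; [exact: i1 | exact: i2].
Qed.

Lemma re_im_continuousM G1 G2 : re_im_continuous G1 -> re_im_continuous G2 ->
  re_im_continuous (fun x => G1 x * G2 x).
Proof.
move=> [r1 i1] [r2 i2]; split=> x.
  under eq_fun do rewrite ReM.
  by apply: cvgB; apply: cvgM; [exact: r1 | exact: r2 | exact: i1 | exact: i2].
under eq_fun do rewrite ImM.
by apply: cvgD; apply: cvgM; [exact: r1 | exact: i2 | exact: i1 | exact: r2].
Qed.

Lemma re_im_continuousV G : re_im_continuous G -> (forall x, G x != 0) ->
  re_im_continuous (fun x => (G x)^-1).
Proof.
move=> [rG iG] G0.
have ReV (z : C) : complex.Re z^-1 =
    complex.Re z / (complex.Re z ^+ 2 + complex.Im z ^+ 2) by case: z.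
have ImV (z : C) : complex.Im z^-1 =
    - (complex.Im z / (complex.Re z ^+ 2 + complex.Im z ^+ 2)) by case: z.
have cn : continuous (fun x => (complex.Re (G x) ^+ 2 + complex.Im (G x) ^+ 2)^-1).
  move=> x; apply: cvgV.
    apply: contra (G0 x); rewrite paddr_eq0 ?sqr_ge0 // !sqrf_eq0 eq_complex /=.
    by [].
  by apply: cvgD; rewrite expr2; under eq_fun do rewrite expr2; apply: cvgM;
    [exact: rG | exact: rG | exact: iG | exact: iG].
split=> x.
  under eq_fun do rewrite ReV.
  by apply: cvgM; [exact: rG | exact: cn].
under eq_fun do rewrite ImV.
by apply: cvgN; apply: cvgM; [exact: iG | exact: cn].
Qed.

Lemma re_im_continuous_prod (I : eqType) (s : seq I) (F : I -> R -> C) :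
  (forall i, i \in s -> re_im_continuous (F i)) ->
  re_im_continuous (fun x => \prod_(i <- s) F i x).
Proof.
elim: s => [|i s IH] Fc.
  by under eq_fun do rewrite big_nil; exact: re_im_continuous_cst.
under eq_fun do rewrite big_cons; apply: re_im_continuousM.
  by apply: Fc; rewrite mem_head.
by apply: IH => j js; apply: Fc; rewrite inE js orbT.
Qed.

Local Notation I02 := (`[0%R, (2 * pi)%R]%classic : set R).
Local Notation mu := (@lebesgue_measure R).

Lemma integrable_continuous (f : R -> R) : continuous f ->
  mu.-integrable I02 (EFin \o f).
Proof.
move=> cf; apply: continuous_compact_integrable; first exact: segment_compact.
exact: continuous_subspaceT.
Qed.

Definition period_integral G : C :=
  (\int[mu]_(x in I02) complex.Re (G x)) +i* (\int[mu]_(x in I02) complex.Im (G x)).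

Lemma period_integral_lin G1 G2 (a : R) : re_im_continuous G1 -> re_im_continuous G2 ->
  period_integral (fun x => G1 x + a%:C * G2 x) =
  period_integral G1 + a%:C * period_integral G2.
Proof.
move=> [r1 i1] [r2 i2]; rewrite /period_integral.
have cZ (f : R -> R) : continuous f -> continuous (fun x => a * f x).
  by move=> cf x; apply: cvgM; [exact: cvg_cst | exact: cf].
have E (f g : R -> R) : continuous f -> continuous g ->
    \int[mu]_(x in I02) (f x + a * g x) =
    \int[mu]_(x in I02) f x + a * \int[mu]_(x in I02) g x.
  move=> cf cg; rewrite RintegralD ?RintegralZl //; try exact: integrable_continuous.
  by apply: integrable_continuous; exact: cZ.
apply/eqP; rewrite eq_complex /=; apply/andP; split; apply/eqP.
  under eq_Rintegral do rewrite raddfD /= ReM /= mul0r subr0.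
  by rewrite E // mul0r subr0.
under eq_Rintegral do rewrite raddfD /= ImM /= mul0r addr0.
by rewrite E // mul0r addr0.
Qed.

Definition fourier_coef G (k : int) : C :=
  period_integral (fun x => G x * cis (- k%:~R * x)) / (2 * pi)%:C.

Lemma cisXz (a : R) (m : int) : cis a ^ m = cis (m%:~R * a).
Proof.
case: m => n; first by rewrite -exprnP cisX.
by rewrite NegzE -exprnN cisX -cisN -mulNr mulrNz.
Qed.

Lemma fourierE (f : C -> C) G k : (forall x, f (cis x) = G x) ->
  fourier f k = fourier_coef G k.
Proof.
move=> fG; rewrite /fourier /circle_integral /fourier_coef /period_integral.
congr ((_ +i* _) / _); apply: eq_Rintegral => x _; rewrite fG cisXz; congr (_ (_ * cis (_ * x)));
  by rewrite mulrNz.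
Qed.

(** Here G' is G / (1 - a e^(i m x)). As multiplication by e^(i m x) shifts the coefficients by m,
    the functional equation yields the recursion with no series expansion. *)
Lemma fourier_coef_shift G G' (a : R) (m : int) k :
  re_im_continuous G -> re_im_continuous G' ->
  (forall x, G' x = G x + a%:C * (cis (m%:~R * x) * G' x)) ->
  fourier_coef G' k - a%:C * fourier_coef G' (k - m) = fourier_coef G k.
Proof.
move=> cG cG' E; apply/eqP; rewrite subr_eq; apply/eqP.
rewrite {1}/fourier_coef.
have -> : (fun x => G' x * cis (- k%:~R * x)) = (fun x => G x * cis (- k%:~R * x) +
    a%:C * (G' x * cis (- (k - m)%:~R * x))).
  apply/funext => x; rewrite {1}E mulrDl; congr (_ + _).
  rewrite -mulrA; congr (_ * _); rewrite mulrAC mulrC -cisD.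
  by congr (_ * cis _); rewrite intrB; ring.
rewrite period_integral_lin; last 2 first.
- exact: re_im_continuousM cG (re_im_continuous_cis _).
- exact: re_im_continuousM cG' (re_im_continuous_cis _).
by rewrite mulrDl mulrA.
Qed.

(** The bound, uniform in k, is what singles out the right solution of the recursion in
    [chomz_bounded]. *)
Lemma fourier_coef_bounded G : re_im_continuous G -> exists M : R, forall k,
  `|complex.Re (fourier_coef G k)| <= M /\ `|complex.Im (fourier_coef G k)| <= M.
Proof.
move=> cG; have [rG iG] := cG.
pose B := \int[mu]_(x in I02) (`|complex.Re (G x)| + `|complex.Im (G x)|).
have cB : continuous (fun x => `|complex.Re (G x)| + `|complex.Im (G x)|).
  by move=> x; apply: cvgD; apply: cvg_norm; [exact: rG | exact: iG].
have bound (f : R -> R) : continuous f ->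
    (forall x, `|f x| <= `|complex.Re (G x)| + `|complex.Im (G x)|) ->
    `|\int[mu]_(x in I02) f x| <= B.
  move=> cf fle; apply: le_trans (le_normr_Rintegral _ (integrable_continuous cf)) _ => //.
  apply: le_Rintegral => //; try exact: integrable_continuous.
  apply: (integrable_continuous (f := fun x => `|f x|)) => x.
  by apply: cvg_norm; exact: cf.
have mul1 (a b : R) : `|b| <= 1 -> `|a * b| <= `|a|.
  by move=> b1; rewrite normrM ler_piMr.
have pi2 : 0 < (2 * pi : R) by rewrite mulr_gt0 ?pi_gt0.
have divC (z : C) (c : R) : z / c%:C = (complex.Re z / c) +i* (complex.Im z / c).
  by rewrite -fmorphV; case: z => a b; simpc.
exists (B / (2 * pi)) => k; rewrite /fourier_coef divC /=.
have [rC iC] := re_im_continuousM cG (re_im_continuous_cis (- k%:~R)).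
rewrite !normrM normfV (gtr0_norm pi2) !ler_pM2r ?invr_gt0 //; split; apply: bound => // x.
  rewrite ReM; apply: le_trans (ler_normB _ _) _.
  by apply: lerD; apply: mul1; [exact: cos_max | exact: sin_max].
rewrite ImM; apply: le_trans (ler_normD _ _) _.
by apply: lerD; apply: mul1; [exact: sin_max | exact: cos_max].
Qed.

Lemma integral_derive_periodic (F f : R -> R) :
  (forall x : R, is_derive x 1 F (f x)) -> continuous f -> F (2 * pi) = F 0 ->
  \int[mu]_(x in I02) f x = 0.
Proof.
move=> dF cf F0; rewrite /Rintegral.
have dFx (x : R) : derivable F x 1 by have d := dF x; exact: ex_derive.
have cF : continuous F by move=> x; apply: differentiable_continuous; apply/derivable1_diffP.
rewrite (@continuous_FTC2 _ f F) ?F0 //=.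
- by rewrite subrr.
- by rewrite mulr_gt0 ?pi_gt0.
- exact: continuous_subspaceT.
- split=> [x _||]; first exact: dFx.
  + by apply: cvg_at_right_filter; exact: cF.
  + by apply: cvg_at_left_filter; exact: cF.
- by move=> x _; rewrite derive1E; have d := dF x; exact: derive_val.
Qed.

Lemma fourier_coef1 k : fourier_coef (fun=> 1) k = (k == 0)%:R.
Proof.
have pi2 : (2 * pi : R) != 0 by rewrite mulf_neq0 ?pnatr_eq0 ?gt_eqF ?pi_gt0.
rewrite /fourier_coef /period_integral.
under eq_Rintegral do rewrite mul1r /=.
under [X in _ +i* X]eq_Rintegral do rewrite mul1r /=.
have [->|k0] := eqVneq k 0.
  under eq_Rintegral do rewrite oppr0 mul0r cos0.
  under [X in _ +i* X]eq_Rintegral do rewrite oppr0 mul0r sin0.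
  have muI : fine (mu I02) = 2 * pi.
    have := congr1 fine (@lebesgue_measure_itv R `[0%R, (2 * pi)%R]).
    by rewrite /= lte_fin mulr_gt0 ?pi_gt0 //= subr0 => E; exact: E.
  rewrite !Rintegral_cst // mul0r mul1r muI -[_ +i* 0]/((2 * pi)%:C) mulfV //.
  by rewrite eq_complex /= negb_and pi2.
have kR : - k%:~R != 0 :> R by rewrite oppr_eq0 intr_eq0.
set a : R := - k%:~R in kR *.
have cis_per : cis (a * (2 * pi)) = 1.
  rewrite /a -mulrNz -cisXz (_ : cis (2 * pi) = 1) ?exp1rz //.
  by rewrite /cis mulr_natl cos2pi sin2pi.
have cos_per : cos (a * (2 * pi)) = 1 by rewrite -[LHS]/(complex.Re (cis _)) cis_per.
have sin_per : sin (a * (2 * pi)) = 0 by rewrite -[LHS]/(complex.Im (cis _)) cis_per.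
have dlin (x : R) : is_derive x 1 (fun y : R => a * y) a.
  apply: is_derive_eq (is_deriveM (is_derive_cst a x 1) (is_derive_id x 1)) _.
  by rewrite /GRing.scale /= mulr1 mulr0 addr0.
have [ccos csin] := re_im_continuous_cis a.
have dsin (x : R) : is_derive x 1 (fun y => sin (a * y)) (cos (a * x) * a).
  exact: (is_derive1_comp (is_derive_sin (a * x)) (dlin x)).
have dcos (x : R) : is_derive x 1 (fun y => cos (a * y)) (- sin (a * x) * a).
  exact: (is_derive1_comp (is_derive_cos (a * x)) (dlin x)).
have -> : \int[mu]_(x in I02) cos (a * x) = 0.
  apply: (@integral_derive_periodic (fun x => a^-1 * sin (a * x))) => // [x|].
    apply: is_derive_eq (is_deriveM (is_derive_cst a^-1 x 1) (dsin x)) _.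
    by rewrite /GRing.scale /= mulr0 addr0 mulrC mulfK.
  by rewrite sin_per !mulr0 sin0 mulr0.
have -> : \int[mu]_(x in I02) sin (a * x) = 0.
  apply: (@integral_derive_periodic (fun x => (- a^-1) * cos (a * x))) => // [x|].
    apply: is_derive_eq (is_deriveM (is_derive_cst (- a^-1) x 1) (dcos x)) _.
    by rewrite /GRing.scale /= mulr0 addr0 (mulrC (- sin _)) mulrA mulNr mulVf // mulN1r opprK.
  by rewrite cos_per mulr0 cos0.
by rewrite -[_ +i* _]/(0 : C) mul0r.
Qed.

End FourierCoefficients.

(** * Test symbols and the resulting values at power sums *)

Section TestSymbols.
Variable R : realType.
Local Notation C := R[i].
Implicit Types (xs ys : seq R) (r : R).

Definition in01 (s : seq R) := all (fun x => 0 < x < 1) s.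
Definition toC (s : seq R) : seq C := [seq x%:C | x <- s].

Definition gen xs ys (theta : R) : C :=
  \prod_(x <- xs) (1 - x%:C * cis theta)^-1 *
  \prod_(y <- ys) (1 - y%:C * cis (- theta))^-1.

Lemma one_sub_cis_neq0 r theta : 0 < r < 1 -> 1 - r%:C * cis theta != 0 :> C.
Proof.
move=> /andP[/ltW r0 r1]; apply: contra_eq_neq (cexp_clog theta r0 r1) => ->.
by rewrite mulr0 eq_sym oner_eq0.
Qed.

Lemma gen_continuous xs ys : in01 xs -> in01 ys -> re_im_continuous (gen xs ys).
Proof.
move=> /allP x01 /allP y01.
have factor (a r : R) : 0 < r < 1 ->
    re_im_continuous (fun theta => (1 - r%:C * cis (a * theta))^-1).
  move=> r01; apply: re_im_continuousV => [|x]; last exact: one_sub_cis_neq0.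
  apply: re_im_continuousD; first exact: re_im_continuous_cst.
  under eq_fun do rewrite -mulNr; apply: re_im_continuousM.
    exact: re_im_continuous_cst.
  exact: re_im_continuous_cis.
apply: re_im_continuousM; apply: re_im_continuous_prod => r.
  by move=> /x01 /(factor 1); under eq_fun do rewrite mul1r.
by move=> /y01 /(factor (-1)); under eq_fun do rewrite mulN1r.
Qed.

Definition gen_coef xs ys := fourier_coef (gen xs ys).

Lemma geo_inv (w : C) : 1 - w != 0 -> (1 - w)^-1 = 1 + w * (1 - w)^-1.
Proof.
by move=> w0; apply: (mulfI w0); rewrite mulrDr mulr1 mulrCA mulfV // mulr1 subrK.
Qed.

Lemma gen_coef_consl x xs ys k : in01 (x :: xs) -> in01 ys ->
  gen_coef (x :: xs) ys k - x%:C * gen_coef (x :: xs) ys (k - 1) = gen_coef xs ys k.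
Proof.
move=> x01 y01; apply: fourier_coef_shift; [|exact: gen_continuous|move=> theta].
  by apply: gen_continuous => //; case/andP: x01.
have nz : 1 - x%:C * cis theta != 0 by apply: one_sub_cis_neq0; case/andP: x01.
by rewrite /gen !big_cons {1}(geo_inv nz) mul1r; ring.
Qed.

Lemma gen_coef_consr y xs ys k : in01 xs -> in01 (y :: ys) ->
  gen_coef xs (y :: ys) k - y%:C * gen_coef xs (y :: ys) (k + 1) = gen_coef xs ys k.
Proof.
move=> x01 y01; rewrite -[1]opprK.
apply: fourier_coef_shift; [|exact: gen_continuous|move=> theta].
  by apply: gen_continuous => //; case/andP: y01.
have nz : 1 - y%:C * cis (- theta) != 0 by apply: one_sub_cis_neq0; case/andP: y01.
by rewrite /gen !big_cons {1}(geo_inv nz) mulrNz mulN1r; ring.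
Qed.

(* Boundedness selects, among the two-sided solutions of the recursion, the one
   vanishing at negative indices. *)
Lemma chomz_bounded (u : int -> C) (p p' : nat -> C) r M : 0 < r < 1 ->
  (forall k, u k - r%:C * u (k - 1) = chomz p k) ->
  (forall k, (0 < k)%N -> p' k = p k + r%:C ^+ k) ->
  (forall k, `|complex.Re (u k)| <= M /\ `|complex.Im (u k)| <= M) ->
  forall k, u k = chomz p' k.
Proof.
move=> /andP[r0 r1] urec pp' uM.
have uneg n : u (Negz n) = 0.
  have iterE j : u (Negz n) = (r ^+ j)%:C * u (Negz (n + j)).
    elim: j => [|j ->]; first by rewrite expr0 mul1r addn0.
    have /eqP := urec (Negz (n + j)); rewrite subr_eq /= add0r => /eqP ->.
    rewrite mulrA -rmorphM -exprSr addnS; congr (_ * u _).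
    by rewrite !NegzE; lia.
  have small (a : R) : (forall j, `|a| <= r ^+ j * M) -> a = 0.
    move=> aM; apply/eqP; rewrite -normr_le0.
    have cM : (fun j => r ^+ j * M) @ \oo --> (0 : R).
      rewrite -[X in _ --> X](mul0r M); apply: cvgM; last exact: cvg_cst.
      by apply: cvg_expr; rewrite gtr0_norm.
    rewrite -(cvg_lim (@Rhausdorff R) cM); apply: limr_ge; first by apply/cvg_ex; exists 0.
    exact: nearW.
  apply/eqP; rewrite eq_complex /=; apply/andP; split; apply/eqP; apply: small => j.
    rewrite (iterE j) ReM /= mul0r subr0 normrM (ger0_norm (exprn_ge0 _ (ltW r0))).
    by apply: ler_wpM2l; [rewrite exprn_ge0 ?ltW | case: (uM (Negz (n + j)))].
  rewrite (iterE j) ImM /= mul0r addr0 normrM (ger0_norm (exprn_ge0 _ (ltW r0))).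
  by apply: ler_wpM2l; [rewrite exprn_ge0 ?ltW | case: (uM (Negz (n + j)))].
have rec k : u k - chomz p' k = r%:C * (u (k - 1) - chomz p' (k - 1)).
  have := chom_pow_recl (@natr_unit C) pp' k; rewrite -urec => /eqP.
  by rewrite subr_eq => /eqP ->; ring.
case=> n; last exact: uneg.
apply/eqP; rewrite -subr_eq0; apply/eqP.
elim: n => [|n IH]; rewrite rec; first by rewrite uneg subrr mulr0.
have -> : n.+1%:Z - 1 = n by lia.
by rewrite IH mulr0.
Qed.

Lemma psum_toC_cons x xs k : psum (toC (x :: xs)) k = psum (toC xs) k + x%:C ^+ k.
Proof. by rewrite /psum /= big_cons addrC. Qed.

Lemma gen_nil : gen [::] [::] = fun=> 1.
Proof. by apply/funext => theta; rewrite /gen !big_nil mulr1. Qed.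

Lemma gen_coef_nilr xs k : in01 xs -> gen_coef xs [::] k = chomz (psum (toC xs)) k.
Proof.
elim: xs k => [|x xs IH] k x01.
  by rewrite /gen_coef gen_nil fourier_coef1 (chomz0 (@natr_unit C)).
have [M bound] := fourier_coef_bounded (@gen_continuous (x :: xs) [::] x01 isT).
have [x1 xs01] : 0 < x < 1 /\ in01 xs by apply/andP.
apply: (chomz_bounded (p := psum (toC xs)) x1 _ _ bound) => [j|j _].
  by rewrite gen_coef_consl // IH.
exact: psum_toC_cons.
Qed.

Lemma gen_coef_nill ys k : in01 ys -> gen_coef [::] ys (- k) = chomz (psum (toC ys)) k.
Proof.
elim: ys k => [|y ys IH] k y01.
  by rewrite /gen_coef gen_nil fourier_coef1 (chomz0 (@natr_unit C)) oppr_eq0.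
have [M bound] := fourier_coef_bounded (@gen_continuous [::] (y :: ys) isT y01).
have [y1 ys01] : 0 < y < 1 /\ in01 ys by apply/andP.
apply: (chomz_bounded (u := fun k => gen_coef [::] (y :: ys) (- k))
  (p := psum (toC ys)) y1 _ _ (fun k => bound (- k))) => [j|j _].
  by rewrite /= opprB [1 - j]addrC gen_coef_consr // IH.
exact: psum_toC_cons.
Qed.

(** Each linear factor removes one y from the symbol, until only [xs] is left. This and the next
    lemma supply the recursions [actR] and [actL]. *)
Lemma act_gen_coefr xs ys k : in01 xs -> in01 ys ->
  act (locator (toC ys)) (fun j => gen_coef xs ys (- j)) k =
  chomz (psum (toC xs)) (- k).
Proof.
move=> x01; elim: ys k => [|y ys IH] k y01.
  by rewrite /locator big_nil act1 gen_coef_nilr.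
have [y1 ys01] : 0 < y < 1 /\ in01 ys by apply/andP.
rewrite -IH //= locator_cons mulrC actM; apply: eq_act => j.
by rewrite act_lin /= opprB [1 - j]addrC gen_coef_consr.
Qed.

Lemma act_gen_coefl xs ys k : in01 xs -> in01 ys ->
  act (locator (toC xs)) (gen_coef xs ys) k = chomz (psum (toC ys)) (- k).
Proof.
move=> x01 y01; elim: xs k x01 => [|x xs IH] k x01.
  by rewrite /locator big_nil act1 -gen_coef_nill // opprK.
have [x1 xs01] : 0 < x < 1 /\ in01 xs by apply/andP.
rewrite -IH //= locator_cons mulrC actM; apply: eq_act => j.
by rewrite act_lin gen_coef_consl.
Qed.

Lemma fourier_symbol xs ys : in01 xs -> in01 ys ->
  fourier (symbol (psum (toC xs)) (psum (toC ys))) = gen_coef xs ys.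
Proof.
move=> x01 y01; apply/funext => k; apply: fourierE => theta.
exact: symbolE.
Qed.

Lemma in01_bound xs : in01 xs -> exists r, [/\ 0 <= r, r < 1 & all (fun x => `|x| <= r) xs].
Proof.
elim: xs => [|x xs IH] /=; first by exists 0; rewrite lexx ltr01.
move=> /andP[/andP[x0 x1] /IH[r [r0 r1 /allP xr]]].
exists (Num.max x r); split; first by rewrite le_max r0 orbT.
  by rewrite gt_max x1 r1.
rewrite gtr0_norm // le_max lexx /=; apply/allP => y /xr yr.
by rewrite le_max yr orbT.
Qed.

Lemma normc_real (a : R) : Normc.normc a%:C = `|a|.
Proof. by rewrite /= expr0n addr0 sqrtr_sqr. Qed.

Lemma psum_toC xs k : psum (toC xs) k = (\sum_(x <- xs) x ^+ k)%:C.
Proof. by rewrite /psum /toC big_map rmorph_sum; apply: eq_bigr => x _; rewrite rmorphXn. Qed.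

Lemma norm_psum_le r xs k : all (fun x => `|x| <= r) xs ->
  `|\sum_(x <- xs) x ^+ k| <= (size xs)%:R * r ^+ k.
Proof.
elim: xs => [|x xs IH] /=; first by rewrite big_nil normr0 mul0r.
move=> /andP[xr /IH le_xs]; rewrite big_cons -natr1 mulrDl mul1r addrC.
apply: le_trans (ler_normD _ _) _; apply: lerD => //.
by rewrite normrX lerXn2r ?nnegrE ?(le_trans _ xr).
Qed.

Lemma cvg_normc_series (c : nat -> R) A r : 0 <= A -> 0 <= r -> r < 1 ->
  (forall k, `|c k| <= A * r ^+ k) ->
  cvgn (series (fun k : nat => Normc.normc (c k.+1)%:C / k.+1%:R)).
Proof.
move=> A0 r0 r1 cle.
apply: (@series_le_cvg _ _ (geometric A r)) => [k|k|k|].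
- by rewrite normc_real divr_ge0.
- by rewrite /= mulr_ge0 ?exprn_ge0.
- rewrite normc_real /= ler_pdivrMr ?ltr0n // (le_trans (cle _)) //.
  rewrite -mulrA ler_wpM2l // exprSr ler_wpM2l ?exprn_ge0 //.
  by rewrite (le_trans (ltW r1)) // ler1n.
- by apply: is_cvg_geometric_series; rewrite ger0_norm.
Qed.

Lemma admissible_psum xs ys : in01 xs -> in01 ys ->
  admissible (psum (toC xs)) (psum (toC ys)).
Proof.
move=> /in01_bound[r [r0 r1 xr]] /in01_bound[s [s0 s1 ys_s]].
split.
- under eq_fun do rewrite psum_toC.
  apply: (@cvg_normc_series (fun k => \sum_(x <- xs) x ^+ k) (size xs)%:R r) => // k.
  exact: norm_psum_le.
- under eq_fun do rewrite psum_toC.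
  apply: (@cvg_normc_series (fun k => \sum_(x <- ys) x ^+ k) (size ys)%:R s) => // k.
  exact: norm_psum_le.
under eq_fun do rewrite !psum_toC -rmorphM.
apply: (@cvg_normc_series (fun k => (\sum_(x <- xs) x ^+ k) * \sum_(y <- ys) y ^+ k)
  ((size xs)%:R * (size ys)%:R) r) => // k.
rewrite normrM mulrAC; apply: ler_pM => //; first exact: norm_psum_le.
apply: le_trans (norm_psum_le k ys_s) _.
by rewrite -[leRHS]mulr1 ler_wpM2l // exprn_ile1 // ltW.
Qed.

Lemma eval_at_psum lam mu l N (P : mpoly (N + N) rat) xs ys :
  is_toeplitz_poly R lam mu P -> (size lam <= l)%N -> (size mu <= l)%N ->
  in01 xs -> in01 ys ->
  evalseq (psum (toC xs)) (psum (toC ys)) P =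
  \det (jt lam mu l (l + (sumn lam + sumn mu)) (psum (toC xs)) (psum (toC ys))).
Proof.
move=> HP szl szm x01 y01.
have /= := HP _ _ (admissible_psum x01 y01); rewrite fourier_symbol // => cvgP.
apply: (cvg_unique (@norm_hausdorff _ C^o) cvgP).
apply: cvg_near_cst; exists (l + size (toC ys))%N => // n /= le_n.
apply: (det_toep_ratio (@natr_unit C) (xs := toC xs)) => // k.
  exact: act_gen_coefr.
exact: act_gen_coefl.
Qed.

End TestSymbols.

(** * Extension to all sequences *)

Section AllSequences.
Variable R : realType.
Local Notation C := R[i].
Implicit Types (p q : nat -> C).

Definition real01 : pred C :=
  fun z => [&& complex.Im z == 0, 0 < complex.Re z & complex.Re z < 1].

Lemma real01_toC (zs : seq C) : all real01 zs ->
  exists2 xs : seq R, in01 xs & zs = toC xs.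
Proof.
move=> zs01; exists (map (@complex.Re R) zs).
  by rewrite /in01 all_map; apply: sub_all zs01 => z /and3P[_ z0 z1] /=; rewrite z0.
rewrite /toC -map_comp -[LHS]map_id; apply/eq_in_map => z /(allP zs01) /and3P[/eqP z0 _ _].
by case: z z0 => a b /= ->.
Qed.

(** The denominators start at 2 so that the points stay below 1. *)
Definition test_point (n : nat) : C := (n.+2%:R^-1)%:C.

Lemma test_point_inj : injective test_point.
Proof.
move=> m n /complexI /invr_inj /eqP; rewrite eqr_nat => /eqP; by case.
Qed.

Lemma test_point_neq0 n : test_point n != 0.
Proof. by rewrite /test_point fmorph_eq0 invr_eq0 pnatr_eq0. Qed.

Lemma test_point_real01 n : real01 (test_point n).
Proof. by rewrite /real01 /= eqxx invr_gt0 ltr0n /= invf_lt1 ?ltr0n // ltr1n. Qed.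

Lemma psum_dense01 f M : line_poly f ->
  (forall p p', (forall k, (0 < k <= M)%N -> p k = p' k) -> f p = f p') ->
  (forall xs : seq R, in01 xs -> f (psum (toC xs)) = 0) -> forall p, f p = 0.
Proof.
move=> Pf f_ext f0.
apply: (psum_dense test_point_inj test_point_neq0 test_point_real01 Pf f_ext).
by move=> zs /real01_toC[xs xs01 ->]; exact: f0.
Qed.

Lemma line_poly_eval N (P : mpoly (N + N) rat) (h : (nat -> C) -> 'I_(N + N) -> C) :
  (forall v, line_poly (h ^~ v)) -> line_poly (fun p => mpoly.mmap ratr (h p) P).
Proof.
move=> Ph; apply: line_poly_sum => m; apply: line_polyM; first exact: line_polyC.
apply: line_poly_prod => v; elim: (m v) => [|e IH]; first exact: line_polyC.
under eq_fun do rewrite exprS; exact: (line_polyM (Ph v) IH).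
Qed.

Lemma line_poly_jtl lam mu l L q : line_poly (fun p => \det (jt lam mu l L p q)).
Proof.
apply: line_poly_det => i j; under eq_fun do rewrite mxE.
exact: (line_poly_sum _ _ (fun e : 'I_L => line_polyM (line_poly_chomz _) (line_polyC _))).
Qed.

Lemma line_poly_jtr lam mu l L p : line_poly (fun q => \det (jt lam mu l L p q)).
Proof.
by under eq_fun do rewrite -det_tr jt_tr; exact: line_poly_jtl.
Qed.

Lemma eq_chomz (p p' : nat -> C) (k : int) M : k <= M%:Z ->
  (forall k, (0 < k <= M)%N -> p k = p' k) -> chomz p k = chomz p' k.
Proof.
case: k => // n le_nM pp'; apply: (eq_chom (@natr_unit C)) => k /andP[k0 kn].
by rewrite pp' // k0 (leq_trans kn).
Qed.

Lemma eq_jtl lam mu l L q p p' :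
  (forall k, (0 < k <= l + sumn lam)%N -> p k = p' k) ->
  jt lam mu l L p q = jt lam mu l L p' q.
Proof.
move=> pp'; apply/matrixP => i j; rewrite !mxE; apply: eq_bigr => e _.
congr (_ * _); apply: eq_chomz pp'.
by have := nth_le_sumn lam i; lia.
Qed.

Lemma eq_jtr lam mu l L p q q' :
  (forall k, (0 < k <= l + sumn mu)%N -> q k = q' k) ->
  jt lam mu l L p q = jt lam mu l L p q'.
Proof. by move=> qq'; rewrite -[LHS]trmxK jt_tr (eq_jtl _ _ _ qq') -jt_tr trmxK. Qed.

(** Density concerns a single sequence, so it is applied twice: p is freed while q is still a power
    sum, then q with p arbitrary. *)
Lemma toeplitz_polyE lam mu l N (P : mpoly (N + N) rat) p q :
  is_toeplitz_poly R lam mu P -> (size lam <= l)%N -> (size mu <= l)%N ->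
  evalseq p q P = \det (jt lam mu l (l + (sumn lam + sumn mu)) p q).
Proof.
move=> HP szl szm.
have line_sub f g : line_poly f -> line_poly g -> line_poly (fun p : nat -> C => f p - g p).
  move=> Pf Pg; under eq_fun do rewrite -mulN1r.
  exact: (line_polyD Pf (line_polyM (line_polyC (-1)) Pg)).
have left ys : in01 ys -> forall p, evalseq p (psum (toC ys)) P =
    \det (jt lam mu l (l + (sumn lam + sumn mu)) p (psum (toC ys))).
  move=> y01 p'; apply/eqP; rewrite -subr_eq0; apply/eqP.
  pose f p := evalseq p (psum (toC ys)) P -
    \det (jt lam mu l (l + (sumn lam + sumn mu)) p (psum (toC ys))).
  (* P involves p_1, ..., p_N, and the h-indices in [jt] are at most l + sumn lam. *)
  apply: (@psum_dense01 f (N + l + sumn lam)) => [|p1 p2 E|xs x01].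
  - apply: line_sub; last exact: line_poly_jtl.
    apply: line_poly_eval => v; case: (fintype.split v) => k; last exact: line_polyC.
    exact: line_poly_coord.
  - rewrite /f (eq_jtl _ _ _ (p' := p2)); last by move=> k k_le; apply: E; lia.
    congr (_ - _); apply: eq_bigr => m _; congr (_ * _); apply: eq_bigr => v _.
    congr (_ ^+ _); case: (fintype.split v) => k //.
    by apply: E; have := ltn_ord k; lia.
  - by rewrite /f (eval_at_psum HP szl szm) ?subrr.
apply/eqP; rewrite -subr_eq0; apply/eqP.
pose f q := evalseq p q P - \det (jt lam mu l (l + (sumn lam + sumn mu)) p q).
apply: (@psum_dense01 f (N + l + sumn mu)) => [|q1 q2 E|ys y01].
- apply: line_sub; last exact: line_poly_jtr.
  apply: line_poly_eval => v; case: (fintype.split v) => k; first exact: line_polyC.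
  exact: line_poly_coord.
- rewrite /f (eq_jtr _ _ _ (q' := q2)); last by move=> k k_le; apply: E; lia.
  congr (_ - _); apply: eq_bigr => m _; congr (_ * _); apply: eq_bigr => v _.
  congr (_ ^+ _); case: (fintype.split v) => k //.
  by apply: E; have := ltn_ord k; lia.
- by rewrite /f left ?subrr.
Qed.

End AllSequences.

Theorem corollary4 (R : realType) (lam mu : seq nat) (N : nat)
    (Rlam Rmu Rlammu : mpoly (N + N)%N rat) :
  is_partition lam -> is_partition mu ->
  is_toeplitz_poly R lam [::] Rlam ->
  is_toeplitz_poly R [::] mu Rmu ->
  is_toeplitz_poly R lam mu Rlammu ->
  Delta (Rlam * Rmu) = Rlammu.
Proof.
(* Rows of [jt] belong to [lam] and columns to [mu], so one size l has to accommodate both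
   partitions. *)
move=> _ _ Hlam Hmu Hlammu; pose l := maxn (size lam) (size mu).
have szl : (size lam <= l)%N by exact: leq_maxl.
have szm : (size mu <= l)%N by exact: leq_maxr.
have evalF p q : evalseq p q Rlam = \det (jacobi_trudi lam l p) :> R[i].
  by rewrite (toeplitz_polyE p q Hlam szl) // det_jt_nilr.
have evalG p q : evalseq p q Rmu = \det (jacobi_trudi mu l q) :> R[i].
  by rewrite (toeplitz_polyE p q Hmu _ szm) // det_jt_nill.
apply/eqP; rewrite -subr_eq0; apply/eqP/(@evalseq_eq0 R[i]) => p q p0 q0.
rewrite rmorphB /= (evalseq_Delta_jt evalF evalG) // (toeplitz_polyE p q Hlammu szl szm).
exact: subrr.
Qed.
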